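(* Let $n\in\mathbb{N}$ and let $G:\mathbb{R}\to\mathbb{R}$ be an even function satisfying the regularity assumptions in the context. Suppose $(m^{(N)})_{N\in\mathbb{N}}\subseteq\mathcal{X}$ and $m\in\mathcal{X}$ satisfy $m^{(N)}(t)\stackrel{w^*}{\to}m(t)$ as $N\to\infty$ for all $t\in\mathbb{R}^+$. Define $u(t)=G*(m(t))$ and $u^{(N)}(t)=G*(m^{(N)}(t))$ for $t\in\mathbb{R}^+$, $N\in\mathbb{N}$, and identify these with functions on $\Omega=\mathbb{R}^+\times\mathbb{R}$ by $u(t,x)=u(t)(x)$ and $u^{(N)}(t,x)=u^{(N)}(t)(x)$. Then, given $R>0$ and an integer $0\leqslant k\leqslant n$, $$\lim_{N\to\infty}\left\|(\partial_x^k u^{(N)})\cdot\mathbf{1}_{\Omega_R}-(\partial_x^k u)\cdot\mathbf{1}_{\Omega_R}\right\|_1=0,$$ where $\Omega_R=[0,R]\times[-R,R]$, $\mathbf{1}_{\Omega_R}$ is its indicator function, and $\|\cdot\|_1$ is the $L^1(\Omega)$-norm.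
   Context: Assumptions on $G$: $G:\mathbb{R}\to\mathbb{R}$ is even, the classical derivative $G^{(k)}$ of order $k$ is defined everywhere, absolutely continuous and integrable on $\mathbb{R}$ for $0\leqslant k<n$, and there exists $F\in BV(\mathbb{R})$ (an integrable function of bounded variation) that agrees with $G^{(n)}$ almost everywhere on $\mathbb{R}$. $\mathbb{R}^+=[0,\infty)$. $C_0(\mathbb{R})$ is the space of continuous real functions on $\mathbb{R}$ vanishing at infinity, with the supremum norm $\|\cdot\|_\infty$; $\mathcal{M}(\mathbb{R})$ is the space of finite signed Radon measures on $\mathbb{R}$, identified with the dual of $C_0(\mathbb{R})$, and $w^*$ is the weak$^*$-topology: $\mu_N\stackrel{w^*}{\to}\mu$ means $\int f\,d\mu_N\to\int f\,d\mu$ for all $f\in C_0(\mathbb{R})$. $B_{\mathcal{M}^+(\mathbb{R})}$ is the set of positive measures of total variation at most $1$. $(G*\mu)(x)=\int_{\mathbb{R}} G(x-y)\,d\mu(y)$. For $t\in\mathbb{R}^+$, $G*(m(t))$ and $G*(m^{(N)}(t))$ belong to $H^n(\mathbb{R})$; $\partial_x^k u(t,\cdot)$ denotes the $k$-th derivative in $x$, which equals $G^{(k)}*(m(t))$ almost everywhere (with $G^{(n)}$ interpreted as its $BV(\mathbb{R})$ representative), and similarly for $u^{(N)}$. $\|\mu\|_{BL}=\sup\{\int f\,d\mu: f\in C_0(\mathbb{R}),\ \|f\|_\infty+\mathrm{Lip}(f)\leqslant 1\}$, where $\mathrm{Lip}(f)$ is the Lipschitz constant, and $d(\mu,\nu)=\|\mu-\nu\|_{BL}$.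 $\mathcal{X}$ is the set of all $d$-continuous maps $m:\mathbb{R}^+\to B_{\mathcal{M}^+(\mathbb{R})}$. *)

(* Defs.v *)
From HB Require Import structures.
From mathcomp Require Import all_boot all_order all_algebra.
From mathcomp Require Import all_classical all_reals all_analysis.

Set Implicit Arguments.
Unset Strict Implicit.
Unset Printing Implicit Defensive.

Import Order.TTheory GRing.Theory Num.Theory.
Import numFieldNormedType.Exports.

Local Open Scope classical_set_scope.
Local Open Scope ring_scope.

Definition absolutely_continuous (R : realType) (f : R -> R) : Prop :=
  forall e : R, 0 < e -> exists2 d : R, 0 < d &
    forall (p : nat) (a b : 'I_p -> R),
      (forall i, a i <= b i) ->
      trivIset [set: 'I_p] (fun i => [set` `]a i, b i[]) ->
      \sum_(i < p) (b i - a i) < d ->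
      \sum_(i < p) `|f (b i) - f (a i)| < e.

Definition integrable_on_line (R : realType) (f : R -> R) : Prop :=
  (@lebesgue_measure R).-integrable setT (fun x => (f x)%:E).

Definition BV_line (R : realType) (F : R -> R) : Prop :=
  integrable_on_line F /\
  exists M : R, forall a b : R, a <= b -> (total_variation a b F <= M%:E)%E.

(* [derive1n k G] is a total function, so that derivability has to be required
   separately; almost everywhere derivability of [derive1n n.-1 G], for [0 < n],
   follows from its absolute continuity. *)
Definition regular_kernel (R : realType) (n : nat) (G : R -> R) : Prop :=
  [/\ forall k : nat, (k.+1 < n)%N ->
        forall x : R, derivable (derive1n k G) x 1,
      forall k : nat, (k < n)%N ->
        absolutely_continuous (derive1n k G) /\
        integrable_on_line (derive1n k G)
    & exists2 F : R -> R, BV_line F &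
        \forall x \ae (@lebesgue_measure R), F x = derive1n n G x].

(* Every finite Borel measure on the real line is Radon, so the positive
   measures of total variation at most 1 are the Borel subprobabilities. *)
Definition sub_meas (R : realType) : Type :=
  subprobability (measurableTypeR R) R.

Definition C0 (R : realType) (f : R -> R) : Prop :=
  [/\ continuous f, f x @[x --> +oo] --> (0 : R)
    & f x @[x --> -oo] --> (0 : R)].

Definition sup_norm (R : realType) (f : R -> R) : \bar R :=
  ereal_sup [set (`|f x|)%:E | x in [set: R]].

Definition Lip (R : realType) (f : R -> R) : \bar R :=
  ereal_sup [set (`|f z.1 - f z.2| / `|z.1 - z.2|)%:E
            | z in [set z : R * R | z.1 != z.2]].

Definition pairing (R : realType) (f : R -> R) (mu : sub_meas R) : R :=
  \int[mu]_(y in [set: measurableTypeR R]) f y.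

(* The BL-norm of the signed measure [mu - nu], the integral of [f] against
   which is [pairing f mu - pairing f nu]. *)
Definition bl_dist (R : realType) (mu nu : sub_meas R) : \bar R :=
  ereal_sup [set (pairing f mu - pairing f nu)%:E
            | f in [set f : R -> R | C0 f /\ (sup_norm f + Lip f <= 1)%E]].

Definition weak_star_cvg (R : realType) (mus : nat -> sub_meas R)
    (mu : sub_meas R) : Prop :=
  forall f : R -> R, C0 f -> pairing f (mus N) @[N --> \oo] --> pairing f mu.

(* Functions of time are defined on the whole of [R], but only their values
   at nonnegative times are ever used. *)
Definition in_X (R : realType) (m : R -> sub_meas R) : Prop :=
  forall t : R, 0 <= t ->
    bl_dist (m s) (m t) @[s --> within [set s : R | 0 <= s] (nbhs t)]
      --> (0%E : \bar R).

Definition convolution (R : realType) (G : R -> R) (mu : sub_meas R) (x : R) :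
    R :=
  \int[mu]_(y in [set: measurableTypeR R]) G (x - y).

(* The derivative is the classical one (with an arbitrary value at the points
   where it does not exist), which for a function in H^n represents the
   distributional derivative of order [k <= n] almost everywhere. *)
Definition partial_x (R : realType) (k : nat) (u : R -> R -> R) (z : R * R) :
    R :=
  derive1n k (u z.1) z.2.

Definition Omega (R : realType) : set (R * R) := [set z | 0 <= z.1].

Definition Omega_box (R : realType) (r : R) : set (R * R) :=
  `[0, r]%classic `*` `[- r, r]%classic.

Definition lebesgue2 (R : realType) :
    {measure set (measurableTypeR R * measurableTypeR R) -> \bar R} :=
  ((@lebesgue_measure R) \x (@lebesgue_measure R))%E.

Definition L1_norm (R : realType) (f : R * R -> R) : \bar R :=
  (\int[lebesgue2 R]_(z in @Omega R) (`|f z|)%:E)%E.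

(* Elements of L^1(Omega) are classes modulo almost everywhere equality; the
   representative [g] is needed because the product sigma-algebra is not
   complete. *)
Definition in_L1 (R : realType) (f : R * R -> R) : Prop :=
  exists2 g : R * R -> R,
    (lebesgue2 R).-integrable (@Omega R) (fun z => (g z)%:E) &
    \forall z \ae lebesgue2 R, Omega z -> f z = g z.

(* Main.v *)
(**
For each k there is an integrable Borel function F_k, equal to G^(k) for k < n
and to the BV representative of G^(n) for k = n, such that d_x^k (G * mu) is
F_k * mu almost everywhere.  Only the integrability of F_k matters for the
limit: Young's inequality bounds the error of replacing F_k by some g in C_0
by |F_k - g|_1, uniformly over subprobabilities, and g * m^(N)(t) converges
pointwise to g * m(t) by weak* convergence, hence in L^1 of the box by
dominated convergence.

The identification of d_x^n (G * mu) rests on the fundamental theorem of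
calculus for the absolutely continuous H = G^(n-1).  The variation of H is again
absolutely continuous, so the Lebesgue-Stieltjes measures of the monotone parts
of H have Radon-Nikodym densities, and H is a primitive of F_n.  By Fubini,
H * mu is a primitive of F_n * mu, and Lebesgue's differentiation theorem
applies for each t.  Measurability in (t, x) comes from t |-> m(t) being a
kernel, which follows from its d-continuity.
*)

Require Import Defs.
From HB Require Import structures.
From mathcomp Require Import all_boot all_order all_algebra.
From mathcomp Require Import all_classical all_reals all_analysis.
From mathcomp Require Import measurable_realfun lra.

Set Implicit Arguments.
Unset Strict Implicit.
Unset Printing Implicit Defensive.

Import Order.TTheory GRing.Theory Num.Theory.
Import numFieldNormedType.Exports.

Local Open Scope classical_set_scope.
Local Open Scope ring_scope.

(** * Absolutely continuous functions and their variation *)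

(** Two exceptional sets shape the last part of the proof. Lebesgue's theorem differentiates G^(n-1)
    * m(t) for each t off a null set of x that depends on t, and [derive1] has arbitrary values
    where no derivative exists, so it is not evident that the exceptional set in (t, x) is
    measurable, let alone null. The remedy is that G^(n-1) * m(t) is continuous in x, so that its
    slopes can be detected by rational increments. For n = 0 no derivative occurs, but m(t) may have
    atoms and so charge translates of the null set where G and its BV representative differ; this
    too has to be shown to happen for almost no (t, x). Values on null sets also enter through
    [Rintegral], which is 0 where an integral is infinite; the estimates are arranged so that this
    default does no harm. *)

(** Families are indexed by any finite type, so that pairs (interval, piece of its partition) and
    the one-element type can serve as indices. *)
Definition ac_modulus (R : realType) (f : R -> R) (e d : R) : Prop :=
  forall (I : finType) (a b : I -> R),
    (forall i, a i <= b i) ->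
    trivIset [set: I] (fun i => [set` `]a i, b i[]) ->
    \sum_i (b i - a i) < d -> \sum_i `|f (b i) - f (a i)| < e.

Lemma absolutely_continuous_modulus (R : realType) (f : R -> R) :
  absolutely_continuous f ->
  forall e, 0 < e -> exists2 d, 0 < d & ac_modulus f e d.
Proof.
move=> acf e e0; have [d d0 fd] := acf e e0; exists d => // I a b ab tab sd.
have bij : {on [pred i : I | true], bijective (@enum_val I I)}.
  by apply: onW_bij; exact: enum_val_bij.
rewrite (reindex _ bij)/=; apply: (fd _ (a \o enum_val) (b \o enum_val)).
- by move=> i; exact: ab.
- by move=> i j _ _ /(tab _ _ Logic.I Logic.I)/enum_val_inj.
- by rewrite (reindex _ bij)/= in sd.
Qed.

Lemma ac_modulus_dist (R : realType) (f : R -> R) (e d : R) :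
  ac_modulus f e d -> forall x y, `|x - y| < d -> `|f x - f y| < e.
Proof.
move=> fed x y; wlog yx : x y / y <= x => [h|].
  by have [/h//|/ltW/h {}h] := leP y x; rewrite distrC => /h; rewrite distrC.
rewrite ger0_norm ?subr_ge0// => xyd.
have := fed unit (fun=> y) (fun=> x).
by rewrite !big_const !card_unit/= !addr0; apply => // -[] [].
Qed.

Lemma itv_partition_nth_nd (R : realType) (a b : R) (s : seq R) :
  itv_partition a b s -> {homo nth b (a :: s) : n m / (n <= m)%N >-> n <= m}.
Proof.
move=> abs; apply: homo_leq => [//|y x z|n]; first exact: le_trans.
have [ns|ns] := ltnP n (size s).
  by case: abs => /(pathP b) /(_ n ns) /ltW.
rewrite [leRHS]nth_default//.
have [{}ns|{}ns] := ltnP n (size s).+1; first exact: itv_partition_nth_le.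
by rewrite nth_default.
Qed.

(** Subdividing disjoint intervals yields disjoint intervals of the same total length, so the same
    [d] works. *)
Lemma ac_modulus_variation (R : realType) (f : R -> R) (e d : R) :
  ac_modulus f e d ->
  forall (I : finType) (a b : I -> R) (s : I -> seq R),
    (forall i, itv_partition (a i) (b i) (s i)) ->
    trivIset [set: I] (fun i => [set` `]a i, b i[]) ->
    \sum_i (b i - a i) < d -> \sum_i variation (a i) (b i) f (s i) < e.
Proof.
move=> fed I a b s abs tab sd.
(* [nth] pads the shorter partitions with their right end, which adds only empty
   intervals. *)
pose m := (\max_i size (s i))%N.
pose x i n := nth (b i) (a i :: s i) n.
have szm i : (size (s i) <= m)%N by exact: leq_bigmax.
have xnd i : {homo x i : n m / (n <= m)%N >-> n <= m}.
  exact: itv_partition_nth_nd.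
have xm i : x i m = b i.
  rewrite /x; have := szm i; rewrite leq_eqVlt => /orP[/eqP <-|ism].
    exact: (itv_partition_nth_size _ (abs i)).
  by rewrite nth_default.
have x0 i : x i 0%N = a i by [].
have -> : \sum_i variation (a i) (b i) f (s i) =
    \sum_(p : I * 'I_m) `|f (x p.1 p.2.+1) - f (x p.1 p.2)|.
  rewrite -(pair_bigA _ (fun i (n : 'I_m) => `|f (x i n.+1) - f (x i n)|))/=.
  apply: eq_bigr => i _.
  rewrite -(big_mkord xpredT (fun n => `|f (x i n.+1) - f (x i n)|)).
  rewrite (big_cat_nat (leq0n (size (s i))) (szm i))/=.
  rewrite [X in _ = _ + X]big_nat [X in _ = _ + X]big1 ?addr0// => n /andP[sn nm].
  have xb k : (size (s i) <= k)%N -> x i k = b i.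
    rewrite leq_eqVlt => /orP[/eqP <-|sk]; last by rewrite /x nth_default.
    exact: (itv_partition_nth_size _ (abs i)).
  by rewrite !xb ?subrr ?normr0// (leq_trans sn).
apply: fed => /=.
- by move=> [i n] /=; exact: xnd.
- move=> [i n] [j k] _ _ [z []] /=; rewrite !in_itv/=.
  move=> /andP[z1 z2] /andP[z3 z4].
  (* Pieces that meet come from original intervals that meet, hence from the same one; monotonicity
     of its partition points then identifies the pieces. *)
  have ij : i = j.
    apply: (tab i j Logic.I Logic.I); exists z; split => /=; rewrite in_itv/=.
      rewrite (le_lt_trans _ z1) ?(lt_le_trans z2)//.
        by rewrite -(xm i); exact: xnd.
      by rewrite -(x0 i); exact: xnd.
    rewrite (le_lt_trans _ z3) ?(lt_le_trans z4)//.
      by rewrite -(xm j); exact: xnd.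
    by rewrite -(x0 j); exact: xnd.
  subst j; congr pair; apply/val_inj/eqP; rewrite eqn_leq /= leqNgt.
  rewrite [in X in _ && X]leqNgt; apply/andP; split; apply/negP => lt.
    have := xnd i _ _ lt; rewrite leNgt => /negP; apply.
    exact: lt_trans z1 z4.
  have := xnd i _ _ lt; rewrite leNgt => /negP; apply.
  exact: lt_trans z3 z2.
- rewrite -(pair_bigA _ (fun i (n : 'I_m) => x i n.+1 - x i n))/=.
  rewrite (eq_bigr (fun i => b i - a i))// => i _.
  by rewrite -(big_mkord xpredT (fun n => x i n.+1 - x i n)) telescope_sumr// xm.
Qed.

Lemma ac_modulus_total_variation (R : realType) (f : R -> R) (e d : R) :
  ac_modulus f e d ->
  forall a b, a <= b -> b - a < d -> (total_variation a b f <= e%:E)%E.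
Proof.
move=> fed a b ab bad; apply: ge_ereal_sup => _ [_ [s abs <-] <-].
rewrite lee_fin ltW//.
have := @ac_modulus_variation R f e d fed unit (fun=> a) (fun=> b) (fun=> s).
rewrite !big_const !card_unit/= !addr0; apply => //.
by move=> [] [].
Qed.

Lemma absolutely_continuous_total_variation_fin_num (R : realType)
    (f : R -> R) : absolutely_continuous f ->
  forall a b, a <= b -> total_variation a b f \is a fin_num.
Proof.
move=> /absolutely_continuous_modulus/(_ 1 ltr01)[d d0 fd].
(* Pieces of length d / 2, strictly below the modulus [d] for the error 1, contribute at most 1
   each; [n] bounds their number. *)
suff H n a b : a <= b -> b - a <= n%:R * (d / 2) ->
    (total_variation a b f <= n%:R%:E)%E.
  move=> a b ab; rewrite ge0_fin_numE ?total_variation_ge0//.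
  apply: le_lt_trans (ltry (Num.bound ((b - a) / (d / 2)))%:R).
  apply: H => //; rewrite -ler_pdivrMr ?divr_gt0// ltW//.
  by rewrite archi_boundP// divr_ge0 ?subr_ge0// ltW// divr_gt0.
elim: n a b => [a b ab|n ih a b ab ban].
  rewrite mul0r subr_le0 => ba; have -> : a = b by apply/le_anti/andP.
  by rewrite total_variationxx.
have d2 : d / 2 < d by lra.
have [bad|dba] := leP (b - a) (d / 2).
  rewrite (le_trans (ac_modulus_total_variation fd ab _))//.
    exact: le_lt_trans d2.
  by rewrite lee_fin ler1n.
rewrite (@total_variationD _ a b (b - d / 2))//; last 2 first.
  lra.
  lra.
rewrite -[n.+1%:R]natr1 EFinD leeD//; last first.
  by apply: (ac_modulus_total_variation fd); lra.
apply: ih; first lra.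
by move: ban; rewrite -[n.+1%:R]natr1 mulrDl mul1r; lra.
Qed.

(* The total variation of [f] on [a, x] for [a <= x], constant for [x <= a] so
   that it is monotone on the whole line. *)
Definition tv_fun (R : realType) (a : R) (f : R -> R) (x : R) : R :=
  fine (total_variation a (Num.max a x) f).

Section tv_fun.
Context {R : realType} (f : R -> R) (acf : absolutely_continuous f) (a : R).

Lemma tv_funB (x y : R) : x <= y ->
  (tv_fun a f y - tv_fun a f x)%:E =
  total_variation (Num.max a x) (Num.max a y) f.
Proof.
move=> xy.
have fin u v := @absolutely_continuous_total_variation_fin_num R f acf u v.
have maxxy : Num.max a x <= Num.max a y by rewrite ge_max !le_max lexx xy/= orbT.
have aM z : a <= Num.max a z by rewrite le_max lexx.
rewrite /tv_fun (@total_variationD _ a (Num.max a y) (Num.max a x) f)//.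
by rewrite fineD ?fin// addrC addKr fineK ?fin.
Qed.

Lemma tv_fun_nd : {homo tv_fun a f : x y / x <= y}.
Proof.
move=> x y xy; rewrite -subr_ge0 -lee_fin tv_funB// total_variation_ge0//.
by rewrite ge_max !le_max lexx xy/= orbT.
Qed.

Lemma tv_fun_ge (x y : R) : x <= y ->
  `|f (Num.max a y) - f (Num.max a x)| <= tv_fun a f y - tv_fun a f x.
Proof.
move=> xy; rewrite -lee_fin tv_funB// total_variation_ge//.
by rewrite ge_max !le_max lexx xy/= orbT.
Qed.

(** On each interval a partition nearly attains the total variation, and the modulus of [f] for e /
    2 bounds the sum of the variations along all these partitions at once. *)
Lemma tv_fun_absolutely_continuous : absolutely_continuous (tv_fun a f).
Proof.
move=> e e0; have e20 : 0 < e / 2 by rewrite divr_gt0.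
have [d d0 fed] := absolutely_continuous_modulus acf e20.
exists d => // p u v uv tuv sd.
(* The other e / 2 is shared equally among the intervals, so the empty family is set apart. *)
case: p => [|p] in u v uv tuv sd *; first by rewrite big_ord0.
pose u' i := Num.max a (u i); pose v' i := Num.max a (v i).
have uv' i : u' i <= v' i.
  by rewrite /u' /v' ge_max !le_max lexx uv/= orbT.
pose n := (e / 2 / p.+1%:R).
have n0 : 0 < n by rewrite divr_gt0.
have /choice[s hs] : forall i, exists s, itv_partition (u' i) (v' i) s /\
    tv_fun a f (v i) - tv_fun a f (u i) - n < variation (u' i) (v' i) f s.
  move=> i.
  have fin : ereal_sup [set x%:E | x in variations (u' i) (v' i) f]
      \is a fin_num.
    exact: absolutely_continuous_total_variation_fin_num.
  have [_ [_ [s us <-] <-] hs] := ub_ereal_sup_adherent n0 fin.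
  exists s; split => //.
  by rewrite -lte_fin EFinB tv_funB.
have svar : \sum_i variation (u' i) (v' i) f (s i) < e / 2.
  apply: (ac_modulus_variation fed); first by move=> i; case: (hs i).
    move=> i j _ _ [z []] /=; rewrite !in_itv/= /u' /v' !gt_max !lt_max.
    move=> /andP[/andP[az uz] zv] /andP[/andP[_ uz'] zv'].
    apply: (tuv i j Logic.I Logic.I); exists z; split => /=; rewrite in_itv/=.
      by rewrite uz/=; move: zv; rewrite ltNge (ltW az).
    by rewrite uz'/=; move: zv'; rewrite ltNge (ltW az).
  apply: le_lt_trans sd; apply: ler_sum => i _; rewrite /u' /v' /Num.max.
  by have := uv i; case: (ltP a (v i)); case: (ltP a (u i)) => *; lra.
apply: le_lt_trans (_ : \sum_i (variation (u' i) (v' i) f (s i) + n) < _).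
  apply: ler_sum => i _; rewrite ger0_norm ?subr_ge0 ?tv_fun_nd//.
  by rewrite -lerBlDr ltW//; case: (hs i).
rewrite big_split/= sumr_const card_ord -mulr_natr /n.
by rewrite divfK ?pnatr_eq0//; lra.
Qed.

End tv_fun.

(** * Densities of monotone absolutely continuous functions *)

Lemma lebesgue_stieltjes_itv_oc (R : realType) (g : cumulative R R) (x y : R) :
  x <= y -> lebesgue_stieltjes_measure g `]x, y]%classic = (g y - g x)%:E.
Proof.
move=> xy; rewrite /lebesgue_stieltjes_measure /measure_extension.
rewrite measurable_mu_extE/=; last exact: is_ocitv.
by rewrite wlength_itv_bnd.
Qed.

Section grid.
Context {R : realType} (a b : R) (ab : a < b).

Definition grid_pt (j i : nat) : R := a + i%:R * ((b - a) / j.+1%:R).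

Definition grid_cell (j i : nat) : set R :=
  `]grid_pt j i, grid_pt j i.+1]%classic.

(* The points of ]a, b] whose cell in the j-th grid lies in U: a finite disjoint
   union of intervals, so that the modulus of absolute continuity applies to it,
   and every point of an open U is in all but finitely many of them. *)
Definition grid_inner (U : set R) (j : nat) : set R :=
  \big[setU/set0]_(i < j.+1 | `[< grid_cell j i `<=` U >]) grid_cell j i.

Lemma grid_ptB j i : grid_pt j i.+1 - grid_pt j i = (b - a) / j.+1%:R.
Proof.
rewrite /grid_pt -natr1 mulrDl mul1r opprD addrACA subrr add0r addrAC subrr.
by rewrite add0r.
Qed.

Lemma grid_pt_nd j : {homo grid_pt j : m n / (m <= n)%N >-> m <= n}.
Proof.
move=> m n mn; rewrite /grid_pt lerD2l ler_wpM2r ?ler_nat//.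
by rewrite divr_ge0 ?subr_ge0 // ltW.
Qed.

Lemma trivIset_grid_cell j : trivIset setT (grid_cell j).
Proof.
move=> m n _ _ [z []]; rewrite /grid_cell/= !in_itv/=.
move=> /andP[z1 z2] /andP[z3 z4]; apply/eqP; rewrite eqn_leq.
rewrite leqNgt [in X in _ && X]leqNgt.
apply/andP; split; apply/negP => /(grid_pt_nd j); rewrite leNgt => /negP; apply.
  exact: lt_le_trans z1 z4.
exact: lt_le_trans z3 z2.
Qed.

Lemma measurable_grid_inner U j : measurable (grid_inner U j).
Proof. by apply: bigsetU_measurable => i _; exact: measurable_itv. Qed.

Lemma grid_inner_sub U j : grid_inner U j `<=` U.
Proof.
rewrite /grid_inner; elim/big_ind: _ => [//|A B AU BU x [/AU|/BU]//|].
by move=> i /asboolP.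
Qed.

Lemma grid_innerE (mu : {measure set (measurableTypeR R) -> \bar R}) U j :
  mu (grid_inner U j) =
  (\sum_(i < j.+1 | `[< grid_cell j i `<=` U >]) mu (grid_cell j i))%E.
Proof.
rewrite /grid_inner (@measure_bigsetU_ord _ _ _ mu j.+1 _ (grid_cell j))//.
  by move=> i; exact: measurable_itv.
move=> m n _ _ /(@trivIset_grid_cell j _ _ Logic.I Logic.I) mn.
exact: val_inj.
Qed.

Lemma grid_cell_ex j x : a < x <= b ->
  exists2 i, (i < j.+1)%N & grid_cell j i x.
Proof.
move=> /andP[ax xb]; pose w := (b - a) / j.+1%:R.
have w0 : 0 < w by rewrite divr_gt0// subr_gt0.
have exn : exists n : nat, (x - a) / w <= n%:R.
  exists j.+1; rewrite ler_pdivrMr// /w mulrC divfK ?pnatr_eq0//; lra.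
(* The least n with (x - a) / w <= n is positive because a < x, and its predecessor indexes the
   cell, which is closed on the right. *)
case: (ex_minnP exn) => -[|i] xi mini.
  by move: xi; rewrite pmulr_lle0 ?invr_gt0// subr_le0 leNgt ax.
exists i.
  apply: mini; rewrite ler_pdivrMr// /w mulrC divfK ?pnatr_eq0//; lra.
rewrite /grid_cell/= in_itv/= /grid_pt -/w -lerBlDl -ltrBrDl.
rewrite -ler_pdivrMr// xi andbT -ltr_pdivlMr// ltNge.
by apply/negP => /mini; rewrite ltnn.
Qed.

(** Once the mesh is smaller than the radius of a ball around x inside U, the whole cell of x lies
    in U. *)
Lemma grid_inner_cover U : open U ->
  U `&` `]a, b] `<=`
  \bigcup_k \bigcap_(j in [set j | (k <= j)%N]) grid_inner U j.
Proof.
move=> oU x [Ux]; rewrite /= in_itv/= => axb.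
have /nbhs_ballP[r /= r0 rU] : nbhs x U by exact: open_nbhs_nbhs.
exists (Num.bound ((b - a) / r)) => // j /= kj.
have [i ij xi] := grid_cell_ex j axb.
rewrite /grid_inner (bigD1 (Ordinal ij))/=; first by left.
apply/asboolP => y; move: xi; rewrite /grid_cell/= !in_itv/=.
move=> /andP[x2 x3] /andP[y2 y3].
apply: rU; rewrite /ball/=.
suff : (b - a) / j.+1%:R < r.
  by rewrite -(grid_ptB j i) => ?; rewrite ltr_norml; apply/andP; split; lra.
rewrite ltr_pdivrMr// mulrC -ltr_pdivrMr//.
have /archi_boundP : 0 <= (b - a) / r by rewrite divr_ge0 ?subr_ge0// ltW.
by move=> /lt_le_trans; apply; rewrite ler_nat (leq_trans kj).
Qed.

End grid.

(** The sets [grid_inner a b U j] need not increase with j, so continuity from below is applied to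
    their tail intersections [V k]. *)
Lemma measure_le_grid (R : realType)
    (mu : {measure set (measurableTypeR R) -> \bar R}) (a b : R) (U : set R)
    (e : \bar R) : a < b -> open U ->
  (forall j, (mu (grid_inner a b U j) <= e)%E) -> (mu (U `&` `]a, b]) <= e)%E.
Proof.
move=> ab oU mue.
pose V k := \bigcap_(j in [set j | (k <= j)%N]) grid_inner a b U j.
have mV k : measurable (V k : set (measurableTypeR R)).
  apply: bigcap_measurableType => i _; exact: measurable_grid_inner.
have mUV : measurable (\bigcup_k V k : set (measurableTypeR R)).
  exact: bigcupT_measurable.
apply: (@le_trans _ _ (mu (\bigcup_k V k))).
  rewrite le_measure ?inE//; last exact: (grid_inner_cover ab oU).
  by apply: measurableI; [exact: open_measurable|exact: measurable_itv].
have cvgV : mu \o V @ \oo --> mu (\bigcup_k V k).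
  apply: nondecreasing_cvg_mu => // m n mn; apply/subsetPset => x Vx j /= nj.
  by apply: Vx => /=; exact: leq_trans nj.
rewrite -(cvg_lim _ cvgV)//; apply: lime_le.
  by apply/cvg_ex; eexists; exact: cvgV.
apply: nearW => k /=; apply: le_trans (mue k).
rewrite le_measure ?inE//; first exact: measurable_grid_inner.
by move=> x; apply => /=.
Qed.

Lemma absolutely_continuous_continuous (R : realType) (f : R -> R) :
  absolutely_continuous f -> continuous f.
Proof.
move=> acf x; apply/cvgrPdist_lt => e e0.
have [d d0 fd] := absolutely_continuous_modulus acf e0.
near=> y; apply: (ac_modulus_dist fd).
by near: y; exact: cvgr_dist_lt.
Unshelve. all: by end_near. Qed.

(** A null set has an open neighbourhood U of Lebesgue measure below the modulus [d]. The grid cells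
    inside U are disjoint intervals of total length less than [d], so the increments of g over them
    add up to less than e, and this bound passes to U. *)
Lemma lebesgue_stieltjes_ac_dominates (R : realType) (g : cumulative R R)
    (a b : R) (N : set R) : absolutely_continuous g -> a < b ->
  measurable N -> lebesgue_measure N = 0%E ->
  lebesgue_stieltjes_measure g (N `&` `]a, b]) = 0%E.
Proof.
move=> acg ab mN N0; apply/eqP; rewrite eq_le measure_ge0 andbT.
apply/lee_addgt0Pr => e e0; rewrite add0e.
have [d d0 ged] := absolutely_continuous_modulus acg e0.
have [|U [oU NU UN]] := lebesgue_regularity_outer mN _ d0.
  by rewrite [ltLHS]N0.
have Ud : (lebesgue_measure U < d%:E)%E.
  rewrite (@measureDI _ (measurableTypeR R) _ lebesgue_measure U N)//; last first.
    exact: open_measurable.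
  rewrite setIidr//.
  by rewrite [X in (_ + X)%E]N0 adde0.
apply: (@le_trans _ _ (lebesgue_stieltjes_measure g (U `&` `]a, b]))).
  rewrite le_measure ?inE//; last exact: setSI.
    by apply: measurableI => //; exact: measurable_itv.
  by apply: measurableI; [exact: open_measurable|exact: measurable_itv].
apply: measure_le_grid => // j; rewrite grid_innerE//.
pose p i := grid_pt a b j i.
have ple i : p i <= p i.+1 by exact: grid_pt_nd.
have cellE (i : nat) : lebesgue_stieltjes_measure g (grid_cell a b j i) =
    (g (p i.+1) - g (p i))%:E by exact: lebesgue_stieltjes_itv_oc.
pose P (i : 'I_j.+1) := `[< grid_cell a b j i `<=` U >].
rewrite (eq_bigr (fun i : 'I_j.+1 => (g (p i.+1) - g (p i))%:E)); last first.
  by move=> i _; exact: cellE.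
rewrite sumEFin lee_fin ltW// big_mkcond/=.
(* The index type is that of all cells; those not inside U are collapsed to a point. *)
have := ged 'I_j.+1 (fun i => p i) (fun i => if P i then p i.+1 else p i).
move=> H; apply: le_lt_trans (H _ _ _).
- by apply: ler_sum => i _; rewrite /P; case: ifP => // _; rewrite ler_norm.
- by move=> i; case: ifP.
- move=> i k _ _ [z []] /=; rewrite !in_itv/=.
  case: ifP => _; last by move=> /andP[/lt_trans/[apply]]; rewrite ltxx.
  case: ifP => _ zi /andP[] => [z1 z2|/lt_trans/[apply]]; last by rewrite ltxx.
  case/andP: zi => z3 z4; apply/val_inj/(@trivIset_grid_cell _ _ _ ab j) => //.
  by exists z; split; rewrite /grid_cell/= in_itv/= -/p ?z1 ?z3 ltW.
- rewrite -lte_fin (le_lt_trans _ Ud)//.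
  apply: (@le_trans _ _ (lebesgue_measure (grid_inner a b U j))).
    rewrite grid_innerE// [leRHS]big_mkcond/= -sumEFin; apply: lee_sum => i _.
    rewrite -/(P i); case: ifP => _; last by rewrite subrr.
    rewrite lebesgue_measure_itv/= lte_fin -EFinB -/(p i) -/(p i.+1).
    by case: ltP => // pi; rewrite lee_fin subr_le0.
  rewrite le_measure ?inE//; first exact: measurable_grid_inner.
    exact: open_measurable.
  exact: grid_inner_sub.
Qed.

Lemma nondecreasing_ac_density (R : realType) (g : R -> R) (a b : R) :
  {homo g : x y / x <= y} -> absolutely_continuous g -> a < b ->
  exists h : R -> R, integrable_on_line h /\
    forall x y, a <= x -> x <= y -> y <= b ->
      ((g y - g x)%:E = \int[lebesgue_measure]_(z in `]x, y]) (h z)%:E)%E.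
Proof.
move=> ndg acg ab.
have rcg : right_continuous g.
  exact/right_continuousW/absolutely_continuous_continuous.
pose gc : cumulative R R := HB.pack g (isCumulative.Build R _ R g ndg rcg).
have mI : measurable (`]a, b]%classic : set (measurableTypeR R)).
  exact: measurable_itv.
have Ify : (lebesgue_stieltjes_measure gc `]a, b]%classic < +oo)%E.
  by rewrite lebesgue_stieltjes_itv_oc ?ltry// ltW.
(* Restricting to ]a, b] makes the measure finite, whatever the growth of g on the line. *)
pose nu := mfrestr mI Ify.
have dom : nu `<< @lebesgue_measure R.
  apply/null_content_dominatesP => N mN N0.
  exact: (@lebesgue_stieltjes_ac_dominates _ gc).
have [h [h0 hfin inth nuh]] := radon_nikodym_sigma_finite dom.
exists (fine \o h); split.
  rewrite /integrable_on_line; apply: eq_integrable inth => // x _.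
  by rewrite /= fineK.
move=> x y ax xy yb.
have mxy : measurable (`]x, y]%classic : set (measurableTypeR R)).
  exact: measurable_itv.
under eq_integral do rewrite /= fineK//.
rewrite -nuh//.
transitivity (lebesgue_stieltjes_measure gc (`]x, y] `&` `]a, b]))%E => //.
rewrite setIidl ?lebesgue_stieltjes_itv_oc//.
by apply: subset_itv; rewrite bnd_simp.
Qed.

(** * The fundamental theorem of calculus *)

Lemma cvge0_near_lt (I : Type) (R : realType) (D : set_system I) {FD : Filter D}
    (u : I -> \bar R) (e : R) :
  u @ D --> (0%E : \bar R) -> 0 < e -> \forall i \near D, (u i < e%:E)%E.
Proof.
move=> u0 e0; apply: (u0 [set y | (y < e%:E)%E]).
apply: open_nbhs_nbhs; split; last by rewrite /= lte_fin.
exact: open_ereal_lt_ereal.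
Qed.

Lemma aeS d (T : measurableType d) (R : realType)
    (mu : {measure set T -> \bar R}) (P Q : T -> Prop) :
  (forall x, P x -> Q x) ->
  (\forall x \ae mu, P x) -> \forall x \ae mu, Q x.
Proof. by apply: filterS; exact: (ae_filter_ringOfSetsType mu). Qed.

Lemma aeS2 d (T : measurableType d) (R : realType)
    (mu : {measure set T -> \bar R}) (P Q S : T -> Prop) :
  (forall x, P x -> Q x -> S x) ->
  (\forall x \ae mu, P x) -> (\forall x \ae mu, Q x) ->
  \forall x \ae mu, S x.
Proof. by apply: filterS2; exact: (ae_filter_ringOfSetsType mu). Qed.

Lemma absolutely_continuous_dominated (R : realType) (f g : R -> R) (c : R) :
  0 < c -> absolutely_continuous g ->
  (forall x y, x <= y -> `|f y - f x| <= c * (g y - g x)) ->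
  absolutely_continuous f.
Proof.
move=> c0 acg fg e e0.
have [d d0 gd] := acg _ (divr_gt0 e0 c0); exists d => // p a b ab tab sd.
have := gd p a b ab tab sd; rewrite ltr_pdivlMr// mulrC; apply: le_lt_trans.
rewrite mulr_sumr; apply: ler_sum => i _; apply: (le_trans (fg _ _ (ab i))).
by rewrite ler_pM2l// ler_norm.
Qed.

(** Jordan decomposition: on [a, b], f = v - w with v the variation of f, and both v and w are
    nondecreasing and absolutely continuous. *)
Lemma absolutely_continuous_density (R : realType) (f : R -> R) (a b : R) :
  absolutely_continuous f -> a < b ->
  exists h : R -> R, integrable_on_line h /\
    forall x y, a <= x -> x <= y -> y <= b ->
      f y - f x = \int[lebesgue_measure]_(z in `]x, y]) h z.
Proof.
move=> acf ab.
pose v := tv_fun a f; pose w x := v x - f (Num.max a x).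
have acv : absolutely_continuous v by exact: tv_fun_absolutely_continuous.
have fv x y : x <= y -> `|f (Num.max a y) - f (Num.max a x)| <= v y - v x.
  exact: tv_fun_ge.
have ndv : {homo v : x y / x <= y} by exact: tv_fun_nd.
have ndw : {homo w : x y / x <= y}.
  move=> x y xy; rewrite /w.
  have := fv _ _ xy; have := ler_norm (f (Num.max a y) - f (Num.max a x)); lra.
have acw : absolutely_continuous w.
  (* An increment of [w] is one of [v] minus one of [f], and the increment of [f] is bounded by that
     of [v]; hence 2. *)
  apply: (absolutely_continuous_dominated (c := 2) _ acv) => // x y xy.
  have := fv _ _ xy; rewrite ler_norml => /andP[f1 f2].
  by rewrite /w ler_norml; apply/andP; split; lra.
have [h1 [ih1 vh]] := nondecreasing_ac_density ndv acv ab.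
have [h2 [ih2 wh]] := nondecreasing_ac_density ndw acw ab.
exists (h1 \- h2); split.
  exact: (@integrableB _ _ _ _ setT measurableT _ _ ih1 ih2).
move=> x y ax xy yb.
have mxy : measurable (`]x, y]%classic : set (measurableTypeR R)).
  exact: measurable_itv.
rewrite RintegralB//; last 2 first.
- exact: integrableS ih1.
- exact: integrableS ih2.
rewrite /Rintegral -vh// -wh//= /w !max_r//; first lra.
exact: le_trans xy.
Qed.

(** Lebesgue's differentiation theorem applies to the integral of h from a, which near a point of
    ]a, b[ differs from f by the constant [f a]. *)
Lemma primitive_derivable_ae (R : realType) (f h : R -> R) (a b : R) :
  integrable_on_line h ->
  (forall x y, a <= x -> x <= y -> y <= b ->
    f y - f x = \int[lebesgue_measure]_(z in `]x, y]) h z) ->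
  \forall x \ae (@lebesgue_measure R), a < x < b ->
    derivable f x 1 /\ derive1 f x = h x.
Proof.
move=> ih fh.
have inth (i : interval R) : lebesgue_measure.-integrable [set` i] (EFin \o h).
  by apply: integrableS ih => //; exact: measurable_itv.
have loch : locally_integrable setT h.
  by apply: open_integrable_locally => //; exact: openT.
have := @FTC1 R h (BRight a) (fun y => inth _) loch.
apply: aeS => x Hx /andP[ax xb].
have [|dF F'x] := Hx; first exact: ax.
have nearF : {near x,
    (fun y => f a + \int[lebesgue_measure]_(t in `]a, y]) h t) =1 f}.
  near=> y; rewrite -(fh a y)//; first lra.
    by apply/ltW; near: y; exact: lt_nbhsr.
  by apply/ltW; near: y; exact: lt_nbhsl.
have dc : is_derive x 1 (cst (f a)) (0 : R) by exact: is_derive_cst.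
have dF' := DeriveDef dF (etrans (esym (derive1E _ _)) F'x).
have := near_eq_is_derive nearF (is_deriveD dc dF').
by rewrite add0r derive1E => -[? ->].
Unshelve. all: by end_near. Qed.

(** The density obtained on a bounded interval is almost everywhere the derivative of f there, hence
    equal to F. *)
Lemma absolutely_continuous_FTC (R : realType) (f F : R -> R) :
  absolutely_continuous f -> integrable_on_line F ->
  (\forall x \ae (@lebesgue_measure R), F x = derive1 f x) ->
  forall x y, x <= y -> f y - f x = \int[lebesgue_measure]_(z in `]x, y]) F z.
Proof.
move=> acf iF Ff x y xy.
(* The right end y + 1 puts all of ]x, y] inside the open interval on which f is differentiated. *)
have [|h [ih fh]] := @absolutely_continuous_density R f x (y + 1) acf.
  lra.
have mxy : measurable (`]x, y]%classic : set (measurableTypeR R)).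
  exact: measurable_itv.
rewrite (fh x y)//; last lra.
rewrite /Rintegral; congr fine; apply: ae_eq_integral => //.
- by apply: measurable_funS (measurable_int _ ih).
- by apply: measurable_funS (measurable_int _ iF).
have := primitive_derivable_ae ih fh.
apply: aeS2 Ff => z -> hz; rewrite /= in_itv/= => /andP[xz zy].
by have [|_ <-//] := hz; rewrite xz (le_lt_trans zy)// ltrDl.
Qed.

(** * Functions vanishing at infinity *)

Lemma integrable_tail (R : realType) (f : R -> R) (e : R) :
  integrable_on_line f -> 0 < e ->
  exists A : R, 0 < A /\
    (\int[lebesgue_measure]_(x in ~` [set` `[- A, A]%R]) `|f x|%:E < e%:E)%E.
Proof.
move=> intf e0; have mf := measurable_int _ intf.
pose D (n : nat) : set (measurableTypeR R) :=
  ~` [set` `[(- n.+1%:R : R), n.+1%:R]].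
have mD n : measurable (D n) by apply: measurableC; exact: measurable_itv.
pose g := (fun x => `|f x|%:E) : R -> \bar R.
have mg : measurable_fun (setT : set (measurableTypeR R)) g.
  by apply/measurable_EFinP/measurableT_comp => //; exact/measurable_EFinP.
have intg : lebesgue_measure.-integrable setT g by exact: integrable_abse intf.
have cv : (\int[lebesgue_measure]_x (g \_ (D n)) x @[n --> \oo] -->
    (0%E : \bar R))%E.
  have [|||||_ _] := @dominated_convergence _ (measurableTypeR R) R
      (@lebesgue_measure R) setT measurableT
      (fun n => g \_ (D n)) (cst 0%E) g.
  - move=> n; apply: (measurable_restrictT g (mD n)).1.
    exact: measurable_funTS mg.
  - exact: measurable_cst.
  - apply: aeW => x _; apply: cvg_near_cst; exists (Num.bound `|x|) => // n /= xn.
    rewrite patchE ifF//; apply/negbTE; rewrite notin_setE /D/= in_itv/=.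
    move=> nh; apply: nh; rewrite -ler_norml (le_trans (ltW (archi_boundP _)))//.
    by rewrite ler_nat (leq_trans xn).
  - exact: intg.
  - apply: aeW => x n _; rewrite patchE; case: ifP => _.
      by rewrite /g /= normr_id.
    by rewrite abse0 /g lee_fin normr_ge0.
  - by rewrite integral0.
have := cvge0_near_lt cv e0.
case=> n _ /(_ n (leqnn n)) ne; exists n.+1%:R; split => //.
by rewrite integral_mkcond.
Qed.

Lemma C0_bounded (R : realType) (f : R -> R) : C0 f ->
  exists M : R, forall x, `|f x| <= M.
Proof.
move=> [cf fy fNy].
have [A [_ fA]] := ((cvgrPdist_lt _ _).1 fy) 1 ltr01.
have [B [_ fB]] := ((cvgrPdist_lt _ _).1 fNy) 1 ltr01.
have : {within `[B, A], continuous (fun x => `|f x|)}.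
  apply: continuous_subspaceT => x; apply: continuous_comp; first exact: cf.
  exact: norm_continuous.
have [BA|AB] := leP B A.
  move=> /(EVT_max BA)[c _ cM]; exists (Num.max 1 `|f c|) => x.
  rewrite le_max; have [xB|Bx] := ltP x B.
    by apply/orP; left; have := fB x xB; rewrite /= sub0r normrN => /ltW.
  have [Ax|xA] := ltP A x.
    by apply/orP; left; have := fA x Ax; rewrite /= sub0r normrN => /ltW.
  by apply/orP; right; apply: cM; rewrite in_itv/= Bx.
move=> _; exists 1 => x; have [xB|Bx] := ltP x B.
  by have := fB x xB; rewrite /= sub0r normrN => /ltW.
by have := fA x (lt_le_trans AB Bx); rewrite /= sub0r normrN => /ltW.
Qed.

Lemma C0_reflect_shift (R : realType) (f : R -> R) (x : R) : C0 f ->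
  C0 (fun y => f (x - y)).
Proof.
move=> [cf fy fNy]; split.
- move=> y; apply: continuous_comp; last exact: cf.
  by apply: cvgB; [exact: cvg_cst|exact: cvg_id].
- apply/cvgrPdist_lt => e e0; have [A [_ fA]] := ((cvgrPdist_lt _ _).1 fNy) e e0.
  exists (x - A); split; first exact: num_real.
  by move=> y xAy; apply: fA; lra.
- apply/cvgrPdist_lt => e e0; have [A [_ fA]] := ((cvgrPdist_lt _ _).1 fy) e e0.
  exists (x - A); split; first exact: num_real.
  by move=> y xAy; apply: fA; lra.
Qed.

(** If |f x| >= e, uniform continuity keeps |f| >= e / 2 on an interval of length d around x, whose
    share e / 2 * d of the integral exceeds the tail when x is far out. *)
Lemma absolutely_continuous_C0 (R : realType) (f : R -> R) :
  absolutely_continuous f -> integrable_on_line f -> C0 f.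
Proof.
move=> acf intf.
suff H e : 0 < e -> exists A : R, forall x, A < `|x| -> `|f x| < e.
  split; first exact: absolutely_continuous_continuous.
  - apply/cvgrPdist_lt => e /H[A fA]; exists (Num.max A 0); split => //.
      exact: num_real.
    move=> x; rewrite gt_max => /andP[Ax x0].
    by rewrite sub0r normrN fA// gtr0_norm.
  - apply/cvgrPdist_lt => e /H[A fA]; exists (Num.min (- A) 0); split => //.
      exact: num_real.
    move=> x; rewrite lt_min => /andP[Ax x0].
    by rewrite sub0r normrN fA// ltr0_norm// ltrNr.
move=> e0; have e20 : 0 < e / 2 by rewrite divr_gt0.
have [d d0 fd] := absolutely_continuous_modulus acf e20.
have [A [A0 fA]] := @integrable_tail R f (e / 2 * d) intf (mulr_gt0 e20 d0).
(* Beyond this distance from 0, the interval of radius d / 2 around x misses [-A, A]. *)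
exists (A + d / 2) => x Ax; rewrite ltNge; apply/negP => efx.
pose J : set (measurableTypeR R) := [set` `]x - d / 2, (x + d / 2)[].
have mJ : measurable J by exact: measurable_itv.
have muJ : lebesgue_measure J = d%:E.
  rewrite /J lebesgue_measure_itv/= lte_fin ifT; last by lra.
  by rewrite -EFinB; congr _%:E; lra.
have JA : J `<=` ~` [set` `[- A, A]].
  move=> y; rewrite /J /= !in_itv/= => /andP[y1 y2]; apply/negP.
  move: Ax; rewrite ltr_normr => /orP[] Ax; rewrite negb_and -!ltNge.
    by apply/orP; right; lra.
  by apply/orP; left; lra.
have fJ y : J y -> e / 2 <= `|f y|.
  rewrite /J /= in_itv/= => /andP[y1 y2].
  have : `|f x - f y| < e / 2.
    apply: (ac_modulus_dist fd); rewrite ltr_norml; apply/andP; split; lra.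
  have := ler_normD (f x - f y) (f y); rewrite subrK; lra.
have : ((e / 2 * d)%:E <= \int[lebesgue_measure]_(y in J) `|f y|%:E)%E.
  have -> : ((e / 2 * d)%:E = \int[lebesgue_measure]_(y in J) (e / 2)%:E)%E.
    by rewrite integral_cst// [X in (_ * X)%E]muJ -EFinM.
  apply: ge0_le_integral => //.
  - by move=> y _; rewrite lee_fin ltW.
  - apply/measurable_EFinP/measurableT_comp => //; apply/measurable_EFinP.
  exact: measurable_funTS (measurable_int _ intf).
apply/negP; rewrite -ltNge; apply: le_lt_trans fA.
apply: ge0_subset_integral => //.
- by apply: measurableC; exact: measurable_itv.
- apply/measurable_EFinP/measurableT_comp => //; apply/measurable_EFinP.
  exact: measurable_funTS (measurable_int _ intf).
Qed.

(** * Measurability in time *)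

Lemma sub_meas_integrable (R : realType) (mu : sub_meas R) (f : R -> R) (M : R) :
  measurable_fun (setT : set (measurableTypeR R)) f -> (forall x, `|f x| <= M) ->
  mu.-integrable setT (EFin \o f).
Proof.
move=> mf fM; apply: measurable_bounded_integrable => //.
  by apply: (le_lt_trans (@sprobability_setT _ _ _ mu)); rewrite ltry.
by exists M; split; [exact: num_real|move=> y My x _ /=; exact: le_trans (ltW My)].
Qed.

Lemma C0_measurable (R : realType) (f : R -> R) :
  C0 f -> measurable_fun (setT : set (measurableTypeR R)) f.
Proof. by move=> [cf _ _]; exact: continuous_measurable_fun. Qed.

Lemma C0_integrable (R : realType) (mu : sub_meas R) (f : R -> R) :
  C0 f -> mu.-integrable setT (EFin \o f).
Proof.
move=> f0; have [M fM] := C0_bounded f0.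
exact: (sub_meas_integrable mu (C0_measurable f0) fM).
Qed.

Lemma pairingZ (R : realType) (mu : sub_meas R) (f : R -> R) (c : R) :
  C0 f -> pairing (fun x => c * f x) mu = c * pairing f mu.
Proof. by move=> f0; apply: RintegralZl => //; exact: C0_integrable. Qed.

(** The supremum in [bl_dist] is one-sided; a negative difference is treated with the test function
    -f. *)
Lemma pairing_bl_dist (R : realType) (f : R -> R) (mu nu : sub_meas R) :
  C0 f -> (sup_norm f + Lip f <= 1)%E ->
  (`|pairing f mu - pairing f nu|%:E <= bl_dist mu nu)%E.
Proof.
move=> f0 f1.
have N0 : C0 (fun x => - 1 * f x).
  case: f0 => cf fy fNy; split.
  - by move=> x; apply: cvgMr; exact: cf.
  - by rewrite -(mulr0 (- 1)); exact: cvgMr.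
  - by rewrite -(mulr0 (- 1)); exact: cvgMr.
have N1 : (sup_norm (fun x => - 1 * f x)%R + Lip (fun x => - 1 * f x)%R <= 1)%E.
  rewrite (_ : sup_norm _ = sup_norm f); last first.
    by congr ereal_sup; apply: eq_imagel => x _; rewrite mulN1r normrN.
  rewrite (_ : Lip _ = Lip f)//; congr ereal_sup; apply: eq_imagel => x _.
  by rewrite !mulN1r -opprD normrN.
have [h|h] := leP 0 (pairing f mu - pairing f nu).
  by rewrite ger0_norm//; apply: ereal_sup_ubound; exists f.
rewrite ltr0_norm//; apply: ereal_sup_ubound; exists (fun x => - 1 * f x) => //.
by rewrite !pairingZ// !mulN1r opprB opprK addrC.
Qed.

(* Freezes [m] at negative times, where nothing is assumed on it. *)
Definition clamp_time (R : realType) (m : R -> sub_meas R) (t : R) : sub_meas R :=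
  m (Num.max t 0).

(** The map t |-> max(t, 0) is 1-Lipschitz with nonnegative values, so continuity within [0, oo[
    becomes continuity on the whole line. *)
Lemma continuous_pairing_clamp (R : realType) (m : R -> sub_meas R) (f : R -> R) :
  in_X m -> C0 f -> (sup_norm f + Lip f <= 1)%E ->
  continuous (fun t => pairing f (clamp_time m t)).
Proof.
move=> mX f0 f1 t; apply/cvgrPdist_lt => e e0.
pose t' : R := Num.max t 0.
have t'0 : 0 <= t' by rewrite le_max lexx orbT.
have : \forall s \near within [set s : R | 0 <= s] (nbhs t'),
    (bl_dist (m s) (m t') < e%:E)%E by exact: cvge0_near_lt (mX _ t'0) e0.
move=> /nbhs_ballP[d /= d0 dt'].
near=> s; rewrite /clamp_time distrC -lte_fin.
apply: (le_lt_trans (pairing_bl_dist _ _ f0 f1)).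
apply: dt' => /=; last by rewrite le_max lexx orbT.
have : `|t - s| < d by near: s; exact: cvgr_dist_lt.
apply: le_lt_trans; rewrite /t'.
have h1 := ler_norm (t - s); have h2 : - (t - s) <= `|t - s|.
  by rewrite -normrN ler_norm.
by case: (ltP t 0); case: (ltP s 0) => *;
  rewrite ler_norml; apply/andP; split; lra.
Unshelve. all: by end_near. Qed.

Section trapezoid.
Context {R : realType} (a b : R) (ab : a < b) (n : nat).
Let N : R := n.+1%:R.
Let N1 : 1 <= N. Proof. by rewrite /N ler1n. Qed.

(* Equal to [1] on [a + 1/N, b] and to [0] outside ]a, b + 1/N[; it converges
   pointwise to the indicator function of ]a, b]. *)
Definition trapezoid (y : R) : R :=
  Num.max 0 (Num.min 1 (Num.min (N * (y - a)) (N * (b - y) + 1))).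

Lemma trapezoid_bounded y : 0 <= trapezoid y <= 1.
Proof. by rewrite /trapezoid le_max lexx/= ge_max ler01 ge_min lexx. Qed.

Lemma trapezoid_Lip x y : `|trapezoid x - trapezoid y| <= N * `|x - y|.
Proof.
wlog xy : x y / y <= x => [h|].
  by have [/h//|/ltW/h] := leP y x; rewrite distrC (distrC x).
rewrite (@ger0_norm _ (x - y)) ?subr_ge0//.
have N0 : 0 <= N * (x - y) by rewrite mulr_ge0 ?subr_ge0// (le_trans ler01).
have e1 : N * (x - a) = N * (y - a) + N * (x - y) by lra.
have e2 : N * (b - x) = N * (b - y) - N * (x - y) by lra.
rewrite /trapezoid e1 e2; move: (N * (x - y)) (N * (y - a)) (N * (b - y)) N0.
move=> d u v d0.
have minL (p q p' q' : R) : `|p - q| <= d -> `|p' - q'| <= d ->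
    `|Num.min p p' - Num.min q q'| <= d.
  rewrite !ler_norml => /andP[h1 h2] /andP[h3 h4].
  by case: (ltP p p'); case: (ltP q q') => *; apply/andP; split; lra.
have maxL (p q : R) : `|p - q| <= d -> `|Num.max 0 p - Num.max 0 q| <= d.
  rewrite !ler_norml => /andP[h1 h2].
  by case: (ltP 0 p); case: (ltP 0 q) => *; apply/andP; split; lra.
apply: maxL; apply: (minL); first by rewrite subrr normr0.
by apply: minL; rewrite ler_norml; apply/andP; split; lra.
Qed.

Lemma trapezoid_C0 : C0 trapezoid.
Proof.
split.
- move=> x; apply/cvgrPdist_lt => e e0; near=> y.
  apply: (le_lt_trans (trapezoid_Lip _ _)); rewrite -ltr_pdivlMl//.
    by near: y; apply: cvgr_dist_lt => //; rewrite mulr_gt0// invr_gt0.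
- apply: cvg_near_cst; exists (b + 1); split; first exact: num_real.
  move=> x bx; rewrite /trapezoid; apply: max_l; rewrite !ge_min; apply/orP; right.
  apply/orP; right; have : 1 * 1 <= N * (x - b) by apply: ler_pM => //; lra.
  lra.
- apply: cvg_near_cst; exists a; split; first exact: num_real.
  move=> x xa; rewrite /trapezoid; apply: max_l; rewrite !ge_min; apply/orP; right.
  by apply/orP; left; rewrite mulr_ge0_le0// ?(le_trans ler01)//; lra.
Unshelve. all: by end_near. Qed.

(** The sup norm is at most 1 <= N and the Lipschitz constant at most N, so (2N)^-1 makes each of
    the two terms at most 1/2. *)
Lemma trapezoid_BL :
  (sup_norm (fun y => (2 * N)^-1 * trapezoid y)%R +
   Lip (fun y => (2 * N)^-1 * trapezoid y)%R <= 1)%E.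
Proof.
have N0 : 0 < N := lt_le_trans ltr01 N1.
have c0 : 0 < (2 * N)^-1 by rewrite invr_gt0 mulr_gt0.
have c1 : (2 * N)^-1 * N = 2^-1.
  by rewrite invfM -mulrA mulVf ?mulr1// gt_eqF.
have -> : (1 = 2^-1%:E + 2^-1%:E :> \bar R)%E by rewrite -EFinD; congr (_%:E); lra.
apply: leeD; apply: ge_ereal_sup.
  move=> _ [y _ <-]; rewrite lee_fin normrM gtr0_norm// -c1 ler_wpM2l ?(ltW c0)//.
  have /andP[t0 t1] := trapezoid_bounded y.
  by rewrite ger0_norm// (le_trans t1).
move=> _ [[x y] /= xy <-]; rewrite lee_fin -mulrBr normrM gtr0_norm//.
rewrite ler_pdivrMr ?normr_gt0 ?subr_eq0// -c1 -mulrA ler_wpM2l ?(ltW c0)//.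
exact: trapezoid_Lip.
Qed.

End trapezoid.

(** Continuity in time is available only against Lipschitz functions in C_0, so the mass of ]a, b]
    is reached as a limit of pairings with trapezoids. *)
Lemma measurable_clamp_itv_oc (R : realType) (m : R -> sub_meas R) (a b : R) :
  in_X m -> a < b ->
  measurable_fun (setT : set (measurableTypeR R))
    (fun t => clamp_time m t `]a, b]%classic).
Proof.
move=> mX ab.
have mI : measurable (`]a, b]%classic : set (measurableTypeR R)).
  exact: measurable_itv.
have T0 n := @trapezoid_C0 R a b n.
apply: (@emeasurable_fun_cvg _ (measurableTypeR R) R setT
  (fun n t => (pairing (trapezoid a b n) (clamp_time m t))%:E)).
  move=> n; apply/measurable_EFinP; apply: continuous_measurable_fun.
  have N0 : (2 * n.+1%:R : R) != 0 by rewrite mulf_neq0// pnatr_eq0.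
  (* Rescaling brings the trapezoid into the set of test functions of [bl_dist]. *)
  rewrite (_ : (fun t => _) = (fun t => (2 * n.+1%:R) *
      pairing (fun y => (2 * n.+1%:R)^-1 * trapezoid a b n y) (clamp_time m t))).
    move=> t; apply: cvgMr; apply: continuous_pairing_clamp => //.
      case: (T0 n) => cf fy fNy; split.
      - by move=> x; apply: cvgMr; exact: cf.
      - by rewrite -(mulr0 (2 * n.+1%:R)^-1); exact: cvgMr.
      - by rewrite -(mulr0 (2 * n.+1%:R)^-1); exact: cvgMr.
    exact: trapezoid_BL.
  by apply/funext => t; rewrite pairingZ// mulrA mulfV// mul1r.
move=> t _.
have -> : clamp_time m t `]a, b]%classic =
    (\int[clamp_time m t]_x (\1_`]a, b]%classic x)%:E)%E.
  by rewrite integral_indic// setIT.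
have intT n := C0_integrable (clamp_time m t) (T0 n).
have [|||||_ _] := @dominated_convergence _ (measurableTypeR R) R
  (clamp_time m t) setT measurableT
  (fun n x => (trapezoid a b n x)%:E) (fun x => (\1_`]a, b]%classic x)%:E)
  (cst 1%E).
- by move=> n; exact: measurable_int (intT n).
- by apply/measurable_EFinP; exact: measurable_indic.
- apply: aeW => x _; apply: cvg_EFin; first exact: nearW.
  (* On ]a, b] the value is 1 once n + 1 >= 1 / (x - a); beyond b it is 0 once n + 1 >= 1 / (x - b);
     up to a it is always 0. *)
  rewrite indicE; have [|xI] := boolP (x \in _).
    rewrite inE /= in_itv/= => /andP[ax xb]; apply: cvg_near_cst.
    exists (Num.bound (x - a)^-1) => // n /= xn; rewrite /trapezoid.
    have n0 : (0 : R) < n.+1%:R by rewrite ltr0n.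
    rewrite (min_l (y := Num.min _ _)) ?max_r// le_min; apply/andP; split.
      rewrite -ler_pdivrMr ?subr_gt0// mul1r ltW//.
      have : 0 <= (x - a)^-1 by rewrite invr_ge0 subr_ge0 ltW.
      by move=> /archi_boundP/lt_le_trans; apply; rewrite ler_nat (leq_trans xn).
    by rewrite lerDr mulr_ge0// ?subr_ge0// ltW.
  move: xI; rewrite notin_setE/= in_itv/= => /negP; rewrite negb_and -leNgt -ltNge.
  move=> /orP[xa|bx]; apply: cvg_near_cst.
    apply: nearW => n; rewrite /trapezoid; apply: max_l.
    by rewrite !ge_min mulr_ge0_le0 ?orbT// ?ler0n// subr_le0.
  exists (Num.bound (x - b)^-1) => // n /= xn; rewrite /trapezoid max_l//.
  rewrite !ge_min; apply/orP; right; apply/orP; right.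
  have xb : 0 < x - b by rewrite subr_gt0.
  suff : 1 <= n.+1%:R * (x - b) by lra.
  rewrite -ler_pdivrMr// mul1r ltW//.
  have : 0 <= (x - b)^-1 by rewrite invr_ge0 ltW.
  by move=> /archi_boundP/lt_le_trans; apply; rewrite ler_nat (leq_trans xn).
- apply: (@sub_meas_integrable R _ (cst 1) 1) => [|x]; first exact: measurable_cst.
  by rewrite normr1.
- apply: aeW => x n _ /=; rewrite lee_fin.
  by have /andP[t0 t1] := trapezoid_bounded a b n x; rewrite ger0_norm.
apply: cvg_trans; apply: near_eq_cvg; apply: nearW => n.
rewrite /pairing /Rintegral fineK//.
exact: (integrable_fin_num measurableT (intT n)).
Qed.

(** Half-open intervals are stable under intersection and generate the Borel sets, so Dynkin's
    theorem applies. *)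
Lemma measurable_clamp (R : realType) (m : R -> sub_meas R) : in_X m ->
  forall B, measurable B ->
  measurable_fun (setT : set (measurableTypeR R)) (fun t => clamp_time m t B).
Proof.
move=> mX.
have oc A : ocitv A -> measurable_fun (setT : set (measurableTypeR R))
    (fun t => clamp_time m t A).
  move=> /ocitvP[->|[[a b] /= ab ->]]; last exact: measurable_clamp_itv_oc.
  by under eq_fun do rewrite measure0; exact: measurable_cst.
(* The total mass may vary with t, and complements are measured by subtracting from it. *)
have mfT : measurable_fun (setT : set (measurableTypeR R))
    (fun t => clamp_time m t setT).
  apply: (@emeasurable_fun_cvg _ (measurableTypeR R) R setT
    (fun n t => clamp_time m t (`](- n%:R), n%:R]%classic : set R))).
    by move=> n; apply: oc; exact: is_ocitv.
  move=> t _.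
  have E : [set: measurableTypeR R] =
      \bigcup_n (`](- n%:R), n%:R]%classic : set R).
    apply/esym/seteqP; split => // x _; exists (Num.bound `|x|) => //=.
    rewrite in_itv/=; have := archi_boundP (normr_ge0 x).
    by rewrite ltr_norml => /andP[-> /ltW ->].
  rewrite [X in clamp_time m t X]E; apply: nondecreasing_cvg_mu => //.
  - by rewrite -E.
  - move=> i j ij; apply/subsetPset; apply: subset_itv; rewrite bnd_simp.
      by rewrite lerN2 ler_nat.
    by rewrite ler_nat.
apply: dynkin_induction => //=.
- by move=> A B; exact: ocitvI.
- move=> S mS HS.
  rewrite (_ : (fun t => _) =
      (fun t => clamp_time m t setT - clamp_time m t S)%E).
    exact: emeasurable_funB.
  apply/funext => t; rewrite -setTD measureD ?setTI//.
  by apply: (le_lt_trans (@sprobability_setT _ _ _ _)); rewrite ltry.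
- move=> F mF tF HF.
  rewrite (_ : (fun t => _) = (fun t => \sum_(0 <= k <oo) clamp_time m t (F k))%E).
    by apply: ge0_emeasurable_sum => // n t _.
  apply/funext => t; rewrite measure_bigcup//.
  by apply: eq_eseriesl => i; rewrite in_setT.
Qed.

(** * Translations and convolutions *)

Lemma measurable_subl (R : realType) (c : R) :
  measurable_fun (setT : set (measurableTypeR R))
    (fun x => c - x : measurableTypeR R).
Proof. by apply: measurable_funB => //; exact: measurable_cst. Qed.

Lemma measurable_subr (R : realType) (c : R) :
  measurable_fun (setT : set (measurableTypeR R))
    (fun x => x - c : measurableTypeR R).
Proof. by apply: measurable_funB => //; exact: measurable_cst. Qed.

Lemma preimage_sub_itv_oc (R : realType) (a b c : R) :
  (fun x => x - c) @^-1` `]a, b]%classic = `]a + c, b + c]%classic.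
Proof.
by apply/seteqP; split => x /=; rewrite !in_itv/= ltrBrDr lerBlDr.
Qed.

(** Lebesgue measure is determined by its values on half-open intervals, whose lengths a translation
    preserves. *)
Lemma lebesgue_measure_translate (R : realType) (c : R) (A : set R) :
  measurable A ->
  pushforward lebesgue_measure (fun x => x - c : measurableTypeR R) A =
  lebesgue_measure A.
Proof.
move=> mA.
pose f : {mfun measurableTypeR R >-> measurableTypeR R} :=
  HB.pack (fun x => x - c : measurableTypeR R)
    (isMeasurableFun.Build _ _ _ _ _ (@measurable_subr R c)).
transitivity (pushforward (@lebesgue_measure R) f A) => //.
apply/esym/lebesgue_measure_unique => //= _ [[a b]] _ <-.
rewrite /pushforward preimage_sub_itv_oc !lebesgue_measure_itv/=.
by rewrite !lte_fin ltrD2r; case: ifP => // _; rewrite -!EFinB; congr (_%:E); lra.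
Qed.

Lemma ge0_integral_translate (R : realType) (f : R -> \bar R) (c : R) :
  measurable_fun (setT : set (measurableTypeR R)) f -> (forall x, (0 <= f x)%E) ->
  (\int[lebesgue_measure]_x f (x - c)%R = \int[lebesgue_measure]_x f x)%E.
Proof.
move=> mf f0.
have := @ge0_integral_pushforward _ _ _ _ R _ (@measurable_subr R c)
  (@lebesgue_measure R) setT f measurableT mf (fun y _ => f0 y).
rewrite preimage_setT => <-; apply: eq_measure_integral => [|mphi A mA _].
  exact: measurable_subr.
exact: lebesgue_measure_translate.
Qed.

Lemma integrable_translate (R : realType) (f : R -> R) (c : R) :
  integrable_on_line f -> integrable_on_line (fun x => f (x - c)).
Proof.
move=> intf; have mf := measurable_int _ intf; apply/integrableP; split.
  by apply: (measurableT_comp mf); exact: measurable_subr.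
rewrite (@ge0_integral_translate R (fun x => `|(f x)%:E|%E) c) => [||//].
  by case/integrableP : intf.
exact: measurableT_comp.
Qed.

Lemma integral_itv_translate (R : realType) (f : R -> R) (a b c : R) :
  integrable_on_line f ->
  \int[lebesgue_measure]_(x in `]a + c, b + c]) f (x - c) =
  \int[lebesgue_measure]_(x in `]a, b]) f x.
Proof.
move=> intf.
have mf := measurable_int _ intf.
have mI : measurable (`]a, b]%classic : set (measurableTypeR R)).
  exact: measurable_itv.
have mJ : measurable (`]a + c, b + c]%classic : set (measurableTypeR R)).
  exact: measurable_itv.
have intfc : (@lebesgue_measure R).-integrable
    ((fun x => x - c) @^-1` `]a, b]%classic) (EFin \o f \o (fun x => x - c)).
  rewrite preimage_sub_itv_oc; apply: (@integrableS _ _ _ _ setT) => //.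
  exact: integrable_translate.
have := @integral_pushforward _ _ _ _ R _ (@measurable_subr R c)
  (@lebesgue_measure R) `]a, b]%classic _ mf intfc mI.
rewrite /Rintegral preimage_sub_itv_oc => /(congr1 fine) /= <-.
congr fine; apply: eq_measure_integral => [|mphi A mA _].
  exact: measurable_subr.
by rewrite [LHS]lebesgue_measure_translate.
Qed.

Section clamp_kernel.
Context {R : realType} (m : R -> sub_meas R) (mX : in_X m).
Notation T := (measurableTypeR R).

(** Indexed by (t, x), although constant in x, because the integrand f (x - y) depends on x. *)
Let kfam (z : T * T) : {measure set T -> \bar R} := clamp_time m z.1.

Let kfam_measurable U : measurable U -> measurable_fun setT (kfam ^~ U).
Proof.
move=> mU; apply: (measurableT_comp (measurable_clamp mX mU)).
exact: measurable_fst.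
Qed.

Let kfam_uub : measure_fam_uub kfam.
Proof.
(* The uniform bound has to be strict, hence 2 for masses at most 1. *)
exists 2 => z; apply: (le_lt_trans (@sprobability_setT _ _ _ _)).
by rewrite lte_fin ltr1n.
Qed.

#[local] HB.instance Definition _ :=
  isKernel.Build _ _ _ _ _ kfam kfam_measurable.
#[local] HB.instance Definition _ :=
  Kernel_isFinite.Build _ _ _ _ _ kfam kfam_uub.

Lemma measurable_integral_clamp (f : R -> \bar R) :
  measurable_fun (setT : set T) f -> (forall x, (0 <= f x)%E) ->
  measurable_fun (setT : set (T * T))
    (fun z => \int[clamp_time m z.1]_y f (z.2 - y)%R)%E.
Proof.
move=> mf f0.
apply: (measurable_fun_integral_finite_kernel
  (fun w : (T * T) * T => f (w.1.2 - w.2)) kfam) => //.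
apply: (measurableT_comp mf); apply: measurable_funB => //.
by apply: measurableT_comp => //; exact: measurable_snd.
Qed.

Lemma measurable_convolution_clamp (F : R -> R) :
  measurable_fun (setT : set T) F ->
  measurable_fun (setT : set (T * T))
    (fun z => convolution F (clamp_time m z.1) z.2).
Proof.
move=> mF; rewrite /convolution /Rintegral.
apply: (measurableT_comp (@fine_measurable R _ measurableT)).
have mFE : measurable_fun (setT : set T) (EFin \o F) by exact/measurable_EFinP.
under eq_fun do rewrite integralE.
apply: emeasurable_funB.
  rewrite (_ : (fun z : T * T => _) = (fun z =>
      \int[clamp_time m z.1]_y (EFin \o F)^\+ (z.2 - y)%R)%E); last first.
    by apply/funext => z; apply: eq_integral => y _; rewrite !funeposE.
  apply: measurable_integral_clamp => [|x]; last exact: funepos_ge0.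
  exact: measurable_funepos.
rewrite (_ : (fun z : T * T => _) = (fun z =>
      \int[clamp_time m z.1]_y (EFin \o F)^\- (z.2 - y)%R)%E); last first.
    by apply/funext => z; apply: eq_integral => y _; rewrite !funenegE.
apply: measurable_integral_clamp => [|x]; last exact: funeneg_ge0.
exact: measurable_funeneg.
Qed.

End clamp_kernel.

Section convolution_integral.
Context {R : realType} (mu : sub_meas R) (F : R -> R).
Notation T := (measurableTypeR R).
Hypothesis mF : measurable_fun (setT : set T) F.

Lemma measurable_sub_pair :
  measurable_fun (setT : set (T * T)) (fun z => F (z.1 - z.2)).
Proof. by apply: (measurableT_comp mF); exact: measurable_funB. Qed.

(** Young's inequality: Tonelli, translation invariance, and mass at most 1. *)
Lemma integral_abs_convolution :
  (\int[lebesgue_measure]_x \int[mu]_y `|F (x - y)|%:E <=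
   \int[lebesgue_measure]_x `|F x|%:E)%E.
Proof.
have mf : measurable_fun (setT : set (T * T)) (fun z => `|F (z.1 - z.2)|%:E).
  by apply/measurable_EFinP/measurableT_comp => //; exact: measurable_sub_pair.
have mFE : measurable_fun (setT : set T) (fun x => `|F x|%:E).
  exact/measurable_EFinP/measurableT_comp.
rewrite (@fubini_tonelli _ _ T T R lebesgue_measure mu
  (fun z => `|F (z.1 - z.2)|%:E)) => [|//|z]; last by rewrite lee_fin.
under eq_integral => y _ do
  rewrite (@ge0_integral_translate R (fun x => `|F x|%:E))//.
rewrite integral_cst//.
rewrite -[leRHS]mule1; apply: lee_pmul => //.
- by apply: integral_ge0 => x _; rewrite lee_fin.
- exact: sprobability_setT.
Qed.

(* Also when [F (x - _)] is not [mu]-integrable: [fine] sends infinite values to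
   [0]. *)
Lemma le_normr_convolution x :
  (`|convolution F mu x|%:E <= \int[mu]_y `|F (x - y)|%:E)%E.
Proof.
rewrite /convolution /Rintegral.
apply: (@le_trans _ _ (`|\int[mu]_y (F (x - y))%:E|)%E).
  by case: (\int[mu]_y (F (x - y))%:E)%E => //=; rewrite normr0 leey.
apply: le_abse_integral => //; apply/measurable_EFinP.
by apply: (measurableT_comp mF); exact: measurable_subl.
Qed.

End convolution_integral.

Section convolution_integrable.
Context {R : realType} (mu : sub_meas R) (F : R -> R).
Notation T := (measurableTypeR R).
Hypothesis intF : integrable_on_line F.

Let mF : measurable_fun (setT : set T) F.
Proof. by apply/measurable_EFinP; exact: measurable_int intF. Qed.

Lemma integrable_sub_pair :
  (lebesgue_measure \x mu)%E.-integrable (setT : set (T * T))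
    (fun z => (F (z.1 - z.2))%:E).
Proof.
have mf : measurable_fun (setT : set (T * T)) (fun z => (F (z.1 - z.2))%:E).
  apply/measurable_EFinP; exact: (measurable_sub_pair mF).
have H := (@integrable12ltyP _ _ T T R lebesgue_measure mu _ mf).2.
apply: H.
apply: (le_lt_trans (integral_abs_convolution mu mF)).
by case/integrableP : intF.
Qed.

Lemma convolution_integrable : integrable_on_line (convolution F mu).
Proof.
have := integrable_fubini_F integrable_sub_pair.
have mI := measurable_fubini_F integrable_sub_pair.
apply: le_integrable => //.
  apply/measurable_EFinP.
  by apply: (measurableT_comp (@fine_measurable R _ measurableT)); exact: mI.
move=> x _ /=; rewrite /convolution /Rintegral /fubini_F /=.
by case: (\int[mu]_y (F (x - y))%:E)%E => //=; rewrite normr0 leey.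
Qed.

Lemma ae_convolution_fin_num : \forall x \ae (@lebesgue_measure R),
  (\int[mu]_y (F (x - y))%:E)%E \is a fin_num.
Proof.
have := integrable_ae measurableT (integrable_fubini_F integrable_sub_pair).
by apply: aeS => x /(_ Logic.I).
Qed.

End convolution_integrable.

Lemma convolution_primitive (R : realType) (mu : sub_meas R) (H F : R -> R) :
  C0 H -> integrable_on_line F ->
  (forall x y, x <= y -> H y - H x = \int[lebesgue_measure]_(z in `]x, y]) F z) ->
  forall x y, x <= y -> convolution H mu y - convolution H mu x =
    \int[lebesgue_measure]_(z in `]x, y]) convolution F mu z.
Proof.
move=> H0 intF HF x y xy.
have mF := measurable_int _ intF.
have mFR : measurable_fun (setT : set (measurableTypeR R)) F.
  by apply/measurable_EFinP.
have mI : measurable (`]x, y]%classic : set (measurableTypeR R)).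
  exact: measurable_itv.
have intH z := C0_integrable mu (C0_reflect_shift z H0).
rewrite /convolution -RintegralB//.
(* The indicator of ]x, y] is made part of the integrand, so that Fubini's theorem is used on the
   whole product. *)
pose f (z : measurableTypeR R * measurableTypeR R) : R :=
  F (z.1 - z.2) * \1_(`]x, y]%classic : set R) z.1.
have intf : (lebesgue_measure \x mu)%E.-integrable setT (EFin \o f).
  apply: (le_integrable _ _ _ (integrable_sub_pair mu intF)) => //.
    apply/measurable_EFinP/measurable_funM; first exact: measurable_sub_pair.
    have m1 := @measurable_indic _ _ R setT _ mI.
    exact: (measurableT_comp m1 measurable_fst).
  move=> z _ /=; rewrite lee_fin normrM ler_piMr//.
  by rewrite indicE; case: (_ \in _); rewrite ?normr1 ?normr0.
have fub := Fubini intf.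
rewrite /Rintegral; congr fine.
transitivity (\int[mu]_w \int[lebesgue_measure]_z (f (z, w))%:E)%E.
  apply: eq_integral => w _.
  rewrite (_ : H (y - w) - H (x - w) =
      \int[lebesgue_measure]_(z in `]x, y]) F (z - w)); last first.
    rewrite HF ?lerD2r//.
    by rewrite -(integral_itv_translate (x - w) (y - w) w intF) !subrK.
  rewrite /Rintegral fineK.
    rewrite integral_mkcond; apply: eq_integral => z _; rewrite /f/= patchE indicE.
    by case: ifP; rewrite ?mulr1 ?mulr0.
  apply: integrable_fin_num => //.
  exact: integrableS (integrable_translate w intF).
rewrite -fub [RHS]integral_mkcond.
apply: ae_eq_integral => //.
- exact: (measurable_fubini_F intf).
- apply/(measurable_restrictT _ mI); apply: measurable_funTS.
  exact: (measurable_int _ (convolution_integrable mu intF)).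
(* [convolution F mu z] is 0 by default where the inner integral is infinite, so the integrands are
   compared only where it is finite, which is almost everywhere. *)
apply: aeS (ae_convolution_fin_num mu intF) => z finz _.
rewrite patchE /f /=; have [zI|zI] := boolP (z \in _).
  rewrite /convolution /Rintegral fineK//; apply: eq_integral => w _.
  by rewrite indicE zI mulr1.
by apply: integral0_eq => w _; rewrite indicE (negbTE zI) mulr0.
Qed.

(** * Convergence on the box *)

(** Up to a small tail F lives on [-A, A]. The truncation is approximated in L^1 of a larger
    interval by a continuous function, which is then cut off continuously. *)
Lemma L1_C0_dense (R : realType) (F : R -> R) (e : R) :
  integrable_on_line F -> 0 < e ->
  exists g : R -> R, [/\ C0 g, integrable_on_line g &
    (\int[lebesgue_measure]_x `|F x - g x|%:E < e%:E)%E].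
Proof.
move=> intF e0; have e20 : 0 < e / 2 by rewrite divr_gt0.
have [A [A0 tailA]] := integrable_tail intF e20.
have mF := measurable_int _ intF.
pose K : set (measurableTypeR R) := [set` `[- A, A]].
pose E : set (measurableTypeR R) := [set` `[- A - 1, A + 1]].
have mK : measurable K by exact: measurable_itv.
have mE : measurable E by exact: measurable_itv.
pose F1 : R -> R := F \_ K.
have F1E x : K x -> F1 x = F x by move=> Kx; rewrite /F1 patchE mem_set.
have F10 x : ~ K x -> F1 x = 0 by move=> Kx; rewrite /F1 patchE memNset.
have intF1 : integrable_on_line F1.
  have := (integrable_mkcond (mu := @lebesgue_measure R) (EFin \o F) mK).1.
  rewrite restrict_EFin; apply.
  exact: integrableS intF.
have [|g_ [cg_ ig_ lim_]] := @approximation_continuous_integrable R E F1 mE _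
    (integrableS measurableT mE (@subsetT _ _) intF1).
  rewrite [X in (X < _)%E]lebesgue_measure_itv/=.
  by case: ifP => // _; rewrite -EFinB ltry.
have := cvge0_near_lt lim_ e20.
case=> n _ /(_ n (leqnn n)) Fg.
(* A cutoff: [1] on [K] and [0] outside [E], while [F1] vanishes outside [K]. *)
pose phi := trapezoid (- A - 1) A 0.
have phi01 x : 0 <= phi x <= 1 by exact: trapezoid_bounded.
have phiK x : K x -> phi x = 1.
  rewrite /K/= in_itv/= => /andP[Ax xA]; rewrite /phi /trapezoid !mul1r.
  by rewrite min_l ?max_r// le_min; apply/andP; split; lra.
have phiE x : ~ E x -> phi x = 0.
  rewrite /E/= in_itv/= => /negP; rewrite negb_and -!ltNge => h.
  rewrite /phi /trapezoid !mul1r; apply: max_l; rewrite !ge_min.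
  by case/orP: h => h; apply/orP; right; apply/orP; [left|right]; lra.
have KE x : K x -> E x.
  by rewrite /K /E/= !in_itv/= => /andP[h1 h2]; apply/andP; split; lra.
pose g x := phi x * g_ n x.
have g0 : C0 g.
  have [cphi _ _] := @trapezoid_C0 R (- A - 1) A 0.
  split.
  - by move=> x; apply: cvgM; [exact: cphi|exact: cg_].
  - apply: cvg_near_cst; exists (A + 1); split; first exact: num_real.
    move=> x Ax; rewrite /g phiE ?mul0r// /E/= in_itv/= => /andP[_].
    by rewrite leNgt Ax.
  - apply: cvg_near_cst; exists (- A - 1); split; first exact: num_real.
    move=> x Ax; rewrite /g phiE ?mul0r// /E/= in_itv/= => /andP[].
    by rewrite leNgt Ax.
have mg := C0_measurable g0.
exists g; split => //.
  have /integrable_mkcond := ig_ n; move=> /(_ mE).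
  apply: le_integrable => //; first exact/measurable_EFinP.
  move=> x _; rewrite patchE; case: ifPn => [_|]; last first.
    by rewrite notin_setE => nE; rewrite /g /= phiE// mul0r normr0.
  rewrite /= lee_fin /g normrM ler_piMl//.
  by case/andP: (phi01 x) => h1 h2; rewrite ger0_norm.
(* |F - g| <= h1 + h2: on K the cutoff is 1 and F = F1; on E outside K, F1 = 0 gives |g| <= |F1 -
   g_n|, and h1 accounts for F; outside E, g = 0. *)
pose h1 := (fun x => `|F x|%:E) \_ (~` K).
pose h2 := (fun z => `|(F1 z - g_ n z)%:E|%E) \_ E.
have mh1 : measurable_fun (setT : set (measurableTypeR R)) h1.
  apply: (measurable_restrictT _ (measurableC mK)).1; apply: measurable_funTS.
  by apply/measurable_EFinP/measurableT_comp => //; apply/measurable_EFinP.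
have mh2 : measurable_fun (setT : set (measurableTypeR R)) h2.
  apply: (measurable_restrictT _ mE).1; apply: measurable_funTS.
  apply: measurableT_comp => //; apply/measurable_EFinP; apply: measurable_funB.
    by apply/measurable_EFinP; exact: measurable_int intF1.
  exact: continuous_measurable_fun.
have h10 x : (0 <= h1 x)%E by rewrite /h1 patchE; case: ifP; rewrite ?lee_fin.
have h20 x : (0 <= h2 x)%E by rewrite /h2 patchE; case: ifP; rewrite ?lee_fin.
apply: (@le_lt_trans _ _ (\int[lebesgue_measure]_x (h1 x + h2 x))%E).
  apply: ge0_le_integral => //.
  - apply/measurable_EFinP/measurableT_comp => //; apply: measurable_funB => //.
    by apply/measurable_EFinP.
  - exact: emeasurable_funD.
  move=> x _; have [Kx|nKx] := pselect (K x).
    rewrite /h1 patchE ifF; last by apply/negbTE; rewrite notin_setE; exact.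
    rewrite add0e /h2 patchE mem_set; last exact: KE.
    by rewrite /= lee_fin F1E// /g phiK// mul1r.
  rewrite /h1 patchE ifT; last by rewrite mem_set.
  rewrite /h2 patchE; case: ifPn => [|].
    rewrite inE => Ex; rewrite /= lee_fin F10// sub0r normrN.
    apply: (le_trans (ler_normB _ _)); rewrite lerD2l /g normrM ler_piMl//.
    by case/andP: (phi01 x) => ? ?; rewrite ger0_norm.
  by rewrite notin_setE => nE; rewrite adde0 /g phiE// mul0r subr0.
rewrite ge0_integralD//.
rewrite -integral_mkcond -[X in (_ + X)%E]integral_mkcond.
by rewrite [e]splitr EFinD lteD.
Qed.

(** If F (x - _) is not mu-integrable, neither is its difference with the bounded g (x - _), so the
    right-hand side is infinite and the default value on the left is harmless. *)
Lemma convolutionB_le (R : realType) (mu : sub_meas R) (F g : R -> R) (x : R) :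
  measurable_fun (setT : set (measurableTypeR R)) F -> C0 g ->
  (`|convolution F mu x - convolution g mu x|%:E <=
   \int[mu]_y `|F (x - y) - g (x - y)|%:E)%E.
Proof.
move=> mF g0.
have ig := C0_integrable mu (C0_reflect_shift x g0).
have mFx : measurable_fun (setT : set (measurableTypeR R)) (fun y => F (x - y)).
  by apply: (measurableT_comp mF); exact: measurable_subl.
have mgx := C0_measurable (C0_reflect_shift x g0).
have [iFg|] := pselect (mu.-integrable setT (fun y => (F (x - y) - g (x - y))%:E)).
  have iF : mu.-integrable setT (fun y => (F (x - y))%:E).
    have := integrableD measurableT iFg ig; apply: eq_integrable => // y _ /=.
    by rewrite -EFinD subrK.
  rewrite /convolution -RintegralB// EFin_normr_Rintegral//.
  by apply: le_abse_integral => //; apply/measurable_EFinP; exact: measurable_funB.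
move=> nint.
have [fin|inf] := ltP (\int[mu]_y `|F (x - y) - g (x - y)|%:E)%E +oo%E.
  exfalso; apply: nint; apply/integrableP; split => //.
  by apply/measurable_EFinP; exact: measurable_funB.
by apply: le_trans inf; rewrite leey.
Qed.

Section box.
Context {R : realType} (r : R) (r_gt0 : 0 < r).
Notation T := (measurableTypeR R).
Notation box := (Omega_box r : set (T * T)).

Lemma measurable_Omega_box : measurable box.
Proof. by apply: measurableX; exact: measurable_itv. Qed.

Lemma lebesgue2_Omega_box : (lebesgue2 R box < +oo)%E.
Proof.
have -> : lebesgue2 R box = (lebesgue_measure `[0%R, r]%classic *
    lebesgue_measure `[(- r)%R, r]%classic)%E.
  by apply: product_measure1E; exact: measurable_itv.
rewrite !lebesgue_measure_itv/=.
by case: ifP => _; case: ifP => _; rewrite ?mul0e ?mule0// -!EFinB -EFinM ltry.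
Qed.

(** The factor r is the length of the time interval; each time slice is enlarged to the whole
    line. *)
Lemma integral_box_le (f : T * T -> \bar R) (c : \bar R) :
  measurable_fun setT f -> (forall z, 0 <= f z)%E -> (0 <= c)%E ->
  (forall t : R, (0 <= t)%R -> \int[lebesgue_measure]_x f (t, x) <= c)%E ->
  (\int[lebesgue2 R]_(z in box) f z <= c * r%:E)%E.
Proof.
move=> mf f0 c0 fc.
have mI : measurable (`[0, r]%classic : set T) by exact: measurable_itv.
rewrite integral_mkcond /lebesgue2.
have mfb : measurable_fun (setT : set (T * T)) (f \_ box).
  apply: (measurable_restrictT _ measurable_Omega_box).1.
  exact: measurable_funTS.
have fb0 z : (0 <= (f \_ box) z)%E by rewrite patchE; case: ifP.
rewrite (@fubini_tonelli1 _ _ T T R lebesgue_measure lebesgue_measure)//.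
have mI2 : @lebesgue_measure R `[0, r]%classic = r%:E.
  by rewrite lebesgue_measure_itv/= lte_fin r_gt0 oppr0 adde0.
rewrite -mI2 -integral_cst// [leRHS]integral_mkcond.
apply: ge0_le_integral => //.
- by move=> t _; apply: integral_ge0.
- exact: (measurable_fun_fubini_tonelli_F _ mfb).
- apply: (measurable_restrictT _ mI).1; exact: measurable_cst.
move=> t _; rewrite /fubini_F patchE; case: ifPn => [|].
  rewrite inE/= in_itv/= => /andP[t0 tr].
  apply: le_trans (fc t t0); apply: ge0_le_integral => //.
  - exact: (measurableT_comp mfb (measurable_pair1 t)).
  - exact: (measurableT_comp mf (measurable_pair1 t)).
  - by move=> x _; rewrite patchE; case: ifP.
rewrite notin_setE => tI; rewrite integral0_eq// => x _.
by rewrite patchE ifF//; apply/negbTE; rewrite notin_setE => -[].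
Qed.

Lemma integral_box_convolution_le (m : R -> sub_meas R) (D : R -> R) :
  in_X m -> measurable_fun (setT : set T) D ->
  (\int[lebesgue2 R]_(z in box) \int[clamp_time m z.1]_y `|D (z.2 - y)|%:E <=
   (\int[lebesgue_measure]_x `|D x|%:E) * r%:E)%E.
Proof.
move=> mX mD.
have mDa : measurable_fun (setT : set T) (fun x => `|D x|%:E).
  exact/measurable_EFinP/measurableT_comp.
apply: integral_box_le.
- by apply: (measurable_integral_clamp mX mDa) => x; rewrite lee_fin.
- by move=> z; apply: integral_ge0 => y _; rewrite lee_fin.
- by apply: integral_ge0 => y _; rewrite lee_fin.
- by move=> t t0; exact: (integral_abs_convolution (clamp_time m t) mD).
Qed.

Lemma cvg_box_convolution_C0 (mN : nat -> R -> sub_meas R) (m : R -> sub_meas R)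
    (g : R -> R) :
  (forall N, in_X (mN N)) -> in_X m ->
  (forall t, 0 <= t -> weak_star_cvg (fun N => mN N t) (m t)) -> C0 g ->
  (\int[lebesgue2 R]_(z in box) `|convolution g (clamp_time (mN N) z.1) z.2 -
     convolution g (clamp_time m z.1) z.2|%:E @[N --> \oo] --> (0 : \bar R))%E.
Proof.
move=> mNX mX mNm g0.
have mg := C0_measurable g0.
have [M0 gM0] := C0_bounded g0; pose M := Num.max 0 M0.
have M_ge0 : 0 <= M by rewrite le_max lexx.
have gM x : `|g x| <= M by rewrite le_max gM0 orbT.
have cM (mu : sub_meas R) x : `|convolution g mu x| <= M.
  rewrite -lee_fin; apply: (le_trans (le_normr_convolution mu mg x)).
  apply: (@le_trans _ _ (\int[mu]_y M%:E)%E).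
    apply: ge0_le_integral => //.
    - apply/measurable_EFinP/measurableT_comp => //.
      by apply: (measurableT_comp mg); exact: measurable_subl.
    - by move=> y _; rewrite lee_fin.
  rewrite integral_cst// -[leRHS]mule1; apply: lee_pmul => //.
  exact: sprobability_setT.
have mb := measurable_Omega_box.
have mc (m' : R -> sub_meas R) : in_X m' ->
    measurable_fun box (fun z => (convolution g (clamp_time m' z.1) z.2)%:E).
  move=> m'X; apply/measurable_EFinP; apply: measurable_funTS.
  exact: measurable_convolution_clamp.
have [|||||_ + _] := @dominated_convergence _ (T * T)%type R (lebesgue2 R) box mb
  (fun N z => (convolution g (clamp_time (mN N) z.1) z.2)%:E)
  (fun z => (convolution g (clamp_time m z.1) z.2)%:E) (cst M%:E).
- by move=> N; exact: mc.
- exact: mc.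
- apply: aeW => z _; apply: cvg_EFin; first exact: nearW.
  apply: mNm; last exact: C0_reflect_shift.
  by rewrite le_max lexx orbT.
- apply: (measurable_bounded_integrable (f := cst M) mb lebesgue2_Omega_box).
    exact: measurable_cst.
  exists M; split; first exact: num_real.
  by move=> y My z _ /=; rewrite ger0_norm// ltW.
- by apply: aeW => z N _ /=; rewrite lee_fin.
exact.
Qed.

Lemma cvg_box_convolution (mN : nat -> R -> sub_meas R) (m : R -> sub_meas R)
    (F : R -> R) :
  (forall N, in_X (mN N)) -> in_X m ->
  (forall t, 0 <= t -> weak_star_cvg (fun N => mN N t) (m t)) ->
  integrable_on_line F ->
  (\int[lebesgue2 R]_(z in box) `|convolution F (clamp_time (mN N) z.1) z.2 -
     convolution F (clamp_time m z.1) z.2|%:E @[N --> \oo] --> (0 : \bar R))%E.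
Proof.
move=> mNX mX mNm intF.
have mF : measurable_fun (setT : set T) F.
  by apply/measurable_EFinP; exact: measurable_int intF.
set u := (X in X @ _ --> _).
have u0 N : (0 <= u N)%E by apply: integral_ge0 => z _; rewrite lee_fin.
suff H e : 0 < e -> \forall N \near \oo, (u N <= e%:E)%E.
  apply/fine_cvgP; split.
    near=> N; rewrite ge0_fin_numE//.
    apply: (@le_lt_trans _ _ 1%:E); last exact: ltry.
    by near: N; exact: H.
  apply/cvgrPdist_le => e e0; near=> N.
  have uN : (u N <= e%:E)%E by near: N; exact: H.
  rewrite /= sub0r normrN ger0_norm ?fine_ge0// -lee_fin fineK//.
  by rewrite ge0_fin_numE// (le_lt_trans uN)// ltry.
(* One third of e goes to each of the two replacements of F by g and one to the convergence for g;
   dividing by r cancels the factor from the time interval. *)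
move=> e0; have eta0 : 0 < e / (3 * r) by rewrite divr_gt0// mulr_gt0.
have [g [g0 ig Fg]] := L1_C0_dense intF eta0.
have mg := C0_measurable g0.
have mb := measurable_Omega_box.
pose A (m' : R -> sub_meas R) (z : T * T) : \bar R :=
  (\int[clamp_time m' z.1]_y `|F (z.2 - y) - g (z.2 - y)|%:E)%E.
have mFg : measurable_fun (setT : set T) (fun x => F x - g x).
  exact: measurable_funB.
have A0 m' z : (0 <= A m' z)%E.
  by apply: integral_ge0 => y _; rewrite lee_fin.
have mA m' : in_X m' -> measurable_fun box (A m').
  move=> m'X; apply: measurable_funTS.
  apply: (@measurable_integral_clamp R m' m'X (fun x => `|F x - g x|%:E)).
    exact/measurable_EFinP/measurableT_comp.
  by move=> x; rewrite lee_fin.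
have Ae m' : in_X m' -> (\int[lebesgue2 R]_(z in box) A m' z <= (e / 3)%:E)%E.
  move=> m'X; apply: (le_trans (integral_box_convolution_le m'X mFg)).
  have -> : (e / 3)%:E = ((e / (3 * r))%:E * r%:E)%E :> \bar R.
    by rewrite -EFinM invfM mulrA divfK// gt_eqF.
  by rewrite lee_pmul2r ?lte_fin// ltW.
have e30 : 0 < e / 3 by rewrite divr_gt0.
pose v N (z : T * T) : \bar R := `|convolution g (clamp_time (mN N) z.1) z.2 -
     convolution g (clamp_time m z.1) z.2|%:E.
have mv N : measurable_fun box (v N).
  apply/measurable_EFinP/measurableT_comp => //; apply: measurable_funB;
  by apply: measurable_funTS; exact: measurable_convolution_clamp.
have cv : (\int[lebesgue2 R]_(z in box) v N z @[N --> \oo] -->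
    (0 : \bar R))%E.
  exact: (cvg_box_convolution_C0 mNX mX mNm g0).
have : \forall N \near \oo,
    (\int[lebesgue2 R]_(z in box) v N z < (e / 3)%:E)%E.
  exact: cvge0_near_lt cv e30.
apply: filterS => N vN.
apply: (@le_trans _ _
  (\int[lebesgue2 R]_(z in box) (A (mN N) z + (v N z + A m z)))%E).
  apply: ge0_le_integral => //.
  - apply/measurable_EFinP/measurableT_comp => //; apply: measurable_funB;
    by apply: measurable_funTS; exact: measurable_convolution_clamp.
  - apply: emeasurable_funD; first exact: mA.
    by apply: emeasurable_funD; [exact: mv|exact: mA].
  move=> z _.
  have h1 := convolutionB_le (clamp_time (mN N) z.1) z.2 mF g0.
  have h2 := convolutionB_le (clamp_time m z.1) z.2 mF g0.
  apply: (le_trans _ (leeD h1 (leeD (lexx (v N z)) h2))).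
  rewrite /v -!EFinD lee_fin.
  set a := convolution F _ _; set b := convolution F _ _.
  set c := convolution g _ _; set d := convolution g _ _.
  have -> : a - b = (a - c) + ((c - d) + (d - b)) by lra.
  rewrite (le_trans (ler_normD _ _))// lerD2l (le_trans (ler_normD _ _))//.
  by rewrite lerD2l (distrC d).
have v0 z : (0 <= v N z)%E by rewrite lee_fin.
rewrite ge0_integralD//; [|exact: mA| |]; last 2 first.
- by move=> z _; apply: adde_ge0.
- by apply: emeasurable_funD; [exact: mv|exact: mA].
rewrite ge0_integralD//; last exact: mA.
have -> : e%:E = ((e / 3)%:E + ((e / 3)%:E + (e / 3)%:E))%E.
  by rewrite -!EFinD; congr (_%:E); lra.
by apply: leeD; [exact: Ae|apply: leeD; [exact: ltW|exact: Ae]].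
Unshelve. all: by end_near. Qed.

End box.

(** * Derivatives of convolutions *)

(* The library's [ae_eq_integral] requires measurability, which the values of
   [derive1] and, for [n = 0], of [G] lack. *)
Section integral_off_null.
Context d (T : measurableType d) (R : realType) (mu : {measure set T -> \bar R}).
Variables (Z : set T) (mZ : measurable Z) (muZ : mu Z = 0%E).

Import HBNNSimple.

(** The integral of f is a supremum over simple functions below f. Cutting such a function to 0 on Z
    keeps its integral and puts it below g, whether or not f and g are measurable. *)
Lemma ge0_le_integral_off_null (f g : T -> \bar R) :
  (forall x, (0 <= f x)%E) -> (forall x, (0 <= g x)%E) ->
  (forall x, ~ Z x -> (f x <= g x)%E) ->
  (\int[mu]_x f x <= \int[mu]_x g x)%E.
Proof.
move=> f0 g0 fg; rewrite !ge0_integralTE//; apply: ge_ereal_sup => _ [h /= hf <-].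
apply: ereal_sup_ge; exists (sintegral mu (proj_nnsfun h (measurableC mZ))).
  exists (proj_nnsfun h (measurableC mZ)) => //= x.
  rewrite mindicE; have [xZ|xZ] := boolP (x \in _).
    by rewrite mulr1 (le_trans (hf x))// fg//; move: xZ; rewrite inE.
  by rewrite mulr0.
rewrite -!integralT_nnsfun le_eqVlt; apply/orP; left; apply/eqP.
apply: ae_eq_integral => //; try exact/measurable_EFinP.
exists Z; split => // x /= /not_implyP[_]; apply: contra_notP => xZ.
by rewrite mindicE mem_set// mulr1.
Qed.

Lemma integral_off_null (D : set T) (f g : T -> \bar R) :
  (forall x, D x -> ~ Z x -> f x = g x) ->
  (\int[mu]_(x in D) f x = \int[mu]_(x in D) g x)%E.
Proof.
move=> fg; rewrite integral_mkcond [RHS]integral_mkcond.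
have {}fg x : ~ Z x -> (f \_ D) x = (g \_ D) x.
  by move=> Zx; rewrite !patchE; case: ifP => //; rewrite inE => /fg; apply.
rewrite integralE [RHS]integralE; congr (_ - _)%E; apply/le_anti/andP; split;
  apply: ge0_le_integral_off_null => // x /fg fgx;
  by rewrite ?funeposE ?funenegE fgx.
Qed.

End integral_off_null.

Lemma continuous_convolution (R : realType) (g : R -> R) (mu : sub_meas R) :
  absolutely_continuous g -> C0 g -> continuous (convolution g mu).
Proof.
move=> acg g0 x; apply/cvgrPdist_le => e e0.
have [d d0 gd] := absolutely_continuous_modulus acg e0.
have ig z := C0_integrable mu (C0_reflect_shift z g0).
near=> y; have xy : `|x - y| < d by near: y; exact: cvgr_dist_lt.
rewrite /convolution -RintegralB// -lee_fin EFin_normr_Rintegral//; last first.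
  exact: (@integrableB _ _ _ _ setT measurableT _ _ (ig x) (ig y)).
have mB : measurable_fun (setT : set (measurableTypeR R))
    (fun w => (g (x - w) - g (y - w))%:E).
  apply/measurable_EFinP; apply: measurable_funB;
  exact: C0_measurable (C0_reflect_shift _ g0).
apply: (le_trans (le_abse_integral mu measurableT mB)).
apply: (@le_trans _ _ (\int[mu]_w e%:E)%E).
  apply: ge0_le_integral => //.
  - exact: measurableT_comp.
  - move=> w _; rewrite /= lee_fin; apply/ltW/(ac_modulus_dist gd).
    by rewrite opprB addrA subrK.
rewrite integral_cst// -[leRHS]mule1; apply: lee_pmul => //.
  by rewrite lee_fin ltW.
exact: sprobability_setT.
Unshelve. all: by end_near. Qed.

(** Absolute continuity of F makes F * mu continuous, so its primitive H * mu has the expected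
    derivative at every point, not only almost everywhere. *)
Lemma derive1_convolution (R : realType) (H F : R -> R) (mu : sub_meas R) :
  C0 H -> absolutely_continuous F -> integrable_on_line F ->
  (forall x y, x <= y -> H y - H x = \int[lebesgue_measure]_(z in `]x, y]) F z) ->
  derive1 (convolution H mu) = convolution F mu.
Proof.
move=> H0 acF intF HF; apply/funext => x.
have F0 := absolutely_continuous_C0 acF intF.
have prim := convolution_primitive mu H0 intF HF.
have inth := convolution_integrable mu intF.
have inti : lebesgue_measure.-integrable
    [set` Interval (BRight (x - 1)) (BRight (x + 1))] (EFin \o convolution F mu).
  by apply: integrableS inth => //; exact: measurable_itv.
have x1 : x < x + 1 by rewrite ltrDl.
have [||] := continuous_FTC1 x1 inti.
- by rewrite /Order.lt/= ltrBlDr ltrDl.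
- exact: continuous_convolution.
move=> dP P'.
have nearP : {near x, (fun y => convolution H mu (x - 1) +
    \int[lebesgue_measure]_(t in `]x - 1, y]) convolution F mu t) =1
    convolution H mu}.
  near=> y; rewrite -(prim (x - 1) y); first by rewrite addrC subrK.
  by apply/ltW; near: y; apply: lt_nbhsr; rewrite ltrBlDr ltrDl.
have dc : is_derive x 1 (cst (convolution H mu (x - 1))) (0 : R).
  exact: is_derive_cst.
have dP' := DeriveDef dP (etrans (esym (derive1E _ _)) P').
have := near_eq_is_derive nearP (is_deriveD dc dP').
by rewrite add0r derive1E => -[_ ->].
Unshelve. all: by end_near. Qed.

(** An enumeration of the rationals; numbers that encode no rational give 0, an increment that
    [has_slope] excludes. *)
Definition rat_seq (R : realType) (n : nat) : R :=
  ratr (odflt 0 (@unpickle rat n)).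

Lemma rat_seq_dense (R : realType) (a b : R) : a < b ->
  exists n, a < rat_seq R n < b.
Proof.
move=> ab; have [q] := rat_in_itvoo ab; rewrite in_itv/= => qab.
by exists (pickle q); rewrite /rat_seq pickleK.
Qed.

(* For a continuous [f] this says that [f] has derivative [c] at [x], with
   countably many increments only, hence measurably in [f], [x] and [c]. *)
Definition has_slope (R : realType) (f : R -> R) (x c : R) : Prop :=
  forall j : nat, exists i : nat, forall n : nat,
    0 < `|rat_seq R n| < i.+1%:R^-1 ->
    `|f (x + rat_seq R n) - f x - c * rat_seq R n| <= `|rat_seq R n| / j.+1%:R.

(** By continuity, a failure of the bound at some increment [h] persists near [h], hence occurs at a
    rational increment. *)
Lemma has_slope_derive1 (R : realType) (f : R -> R) (x c : R) :
  continuous f -> has_slope f x c -> derive1 f x = c.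
Proof.
move=> cf fxc; rewrite /derive1; apply/cvg_lim => //.
apply/cvgrPdist_le => e e0.
pose j := Num.bound e^-1.
have je : j.+1%:R^-1 <= e.
  rewrite -[leRHS]invrK lef_pV2 ?posrE ?invr_gt0//.
  have /archi_boundP/ltW/le_trans : 0 <= e^-1 by rewrite invr_ge0 ltW.
  by apply; rewrite ler_nat.
have [i hi] := fxc j.
have i0 : (0 : R) < i.+1%:R^-1 by rewrite invr_gt0.
near=> h.
have h0 : h != 0 by near: h; exact: nbhs_dnbhs_neq.
have hlt : `|h| < i.+1%:R^-1.
  near: h; apply: dnbhs0_lt => //.
suff : `|f (x + h) - f x - c * h| <= `|h| * e.
  have -> : c - h^-1 *: (f (h + x) - f x) = - (h^-1 * (f (x + h) - f x - c * h)).
    rewrite (addrC h x) [_ *: _]/(_ * _) [in RHS]mulrBr [in RHS](mulrC c).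
    by rewrite mulKf// opprB.
  by rewrite normrN normrM normfV ler_pdivrMl ?normr_gt0.
rewrite leNgt; apply/negP => hbad.
pose phi (y : R) := `|f (x + y) - f x - c * y| - `|y| * e.
have cphi : continuous phi.
  move=> y; apply: cvgB.
    apply: cvg_norm; apply: cvgB.
      2: by apply: cvgM; [exact: cvg_cst|exact: cvg_id].
    apply: cvgB; last exact: cvg_cst.
    apply: continuous_comp; last exact: cf.
    by apply: cvgD; [exact: cvg_cst|exact: cvg_id].
  by apply: cvgM; [apply: cvg_norm; exact: cvg_id|exact: cvg_cst].
have : \forall y \near h, 0 < phi y /\ 0 < `|y| < i.+1%:R^-1.
  near=> y; split.
    near: y; apply: (cvgr_gt (phi h)); first exact: cphi.
    by rewrite /phi subr_gt0.
  apply/andP; split; near: y.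
    apply: (cvgr_gt `|h|); first exact: norm_continuous.
    by rewrite normr_gt0.
  by apply: (cvgr_lt `|h|) => //; exact: norm_continuous.
move=> /nbhs_ballP[d /= d0 hd].
have [|n /andP[n1 n2]] := @rat_seq_dense R (h - d) (h + d); first lra.
have [|pn n01] := hd (rat_seq R n).
  by rewrite /ball/= ltr_norml; apply/andP; split; lra.
have := hi n n01; apply/negP; rewrite -ltNge.
move: pn; rewrite /phi subr_gt0; apply: le_lt_trans.
by rewrite ler_wpM2l.
Unshelve. all: by end_near. Qed.

Lemma derive1_has_slope (R : realType) (f : R -> R) (x : R) :
  derivable f x 1 -> has_slope f x (derive1 f x).
Proof.
move=> df j; rewrite derive1E.
have /cvgrPdist_le/(_ j.+1%:R^-1) := df.
rewrite invr_gt0 ltr0n => /(_ isT)[d /= d0 hd].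
exists (Num.bound d^-1) => n /andP[n0 nd]; set q := rat_seq R n in n0 nd *.
have q0 : q != 0 by rewrite -normr_gt0.
have qd : `|q| < d.
  apply: (lt_le_trans nd); rewrite -[leRHS]invrK lef_pV2 ?posrE ?invr_gt0//.
  have /archi_boundP/ltW/le_trans : 0 <= d^-1 by rewrite invr_ge0 ltW.
  by apply; rewrite ler_nat.
have := hd q; rewrite /ball/= sub0r normrN => /(_ qd q0).
rewrite [q *: 1]mulr1; set D := 'D_1 f x.
have -> : D - q^-1 *: (f (q + x) - f x) = - (q^-1 * (f (x + q) - f x - D * q)).
  rewrite (addrC q x) [_ *: _]/(_ * _) [in RHS]mulrBr [in RHS](mulrC D).
  by rewrite mulKf// opprB.
by rewrite normrN normrM normfV ler_pdivrMl// (mulrC `|q|) mulrC.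
Qed.

Section joint.
Context {R : realType}.
Notation T := (measurableTypeR R).

Lemma measurable_has_slope (f W : T * T -> R) :
  measurable_fun (setT : set (T * T)) f -> measurable_fun (setT : set (T * T)) W ->
  measurable ([set z | has_slope (fun y => f (z.1, y)) z.2 (W z)] : set (T * T)).
Proof.
move=> mf mW.
pose S j i n : set (T * T) := [set z | 0 < `|rat_seq R n| < i.+1%:R^-1 ->
  `|f (z.1, z.2 + rat_seq R n) - f z - W z * rat_seq R n| <=
  `|rat_seq R n| / j.+1%:R].
rewrite (_ : [set z | _] = \bigcap_j \bigcup_i \bigcap_n S j i n); last first.
  apply/seteqP; split => -[t x] /= H j.
    by have [i hi] := H j; exists i => // n _; exact: hi.
  by have [i _ hi] := H j Logic.I; exists i => n; exact: (hi n Logic.I).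
apply: bigcapT_measurable => j; apply: bigcupT_measurable => i.
apply: bigcapT_measurable => n.
(* This condition does not involve z, so [S j i n] is either everything or a sublevel set of a
   measurable function. *)
have [c|nc] := pselect (0 < `|rat_seq R n| < i.+1%:R^-1); last first.
  rewrite (_ : S j i n = setT); first exact: measurableT.
  by apply/seteqP; split => // z _ /nc.
pose g z := `|f (z.1, z.2 + rat_seq R n) - f z - W z * rat_seq R n|.
have mg : measurable_fun (setT : set (T * T)) g.
  apply: measurableT_comp => //; apply: measurable_funB; last first.
    by apply: measurable_funM => //; exact: measurable_cst.
  apply: measurable_funB => //; apply: (measurableT_comp mf).
  apply/measurable_fun_pairP; split => /=; first exact: measurable_fst.
  by apply: measurable_funD; [exact: measurable_snd|exact: measurable_cst].
rewrite (_ : S j i n = setT `&` g @^-1` `]-oo, `|rat_seq R n| / j.+1%:R]).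
  by apply: mg => //; exact: measurable_itv.
apply/seteqP; split => z /=; rewrite in_itv/=.
  by move=> /(_ c).
by move=> [_ gz] _.
Qed.

(** The set [B] where [has_slope] fails is measurable. Its sections are null because derivability
    implies [has_slope], so [B] is null by the definition of the product measure; it contains every
    exceptional point of the box because [has_slope] and continuity give the derivative. *)
Lemma ae_derive1_section (r : R) (f W : T * T -> R) :
  measurable_fun (setT : set (T * T)) f -> measurable_fun (setT : set (T * T)) W ->
  (forall t, continuous (fun x => f (t, x))) ->
  (forall t, \forall x \ae (@lebesgue_measure R), - r <= x <= r ->
    derivable (fun y => f (t, y)) x 1 /\ derive1 (fun y => f (t, y)) x = W (t, x)) ->
  \forall z \ae lebesgue2 R, Omega_box r z ->
    derive1 (fun y => f (z.1, y)) z.2 = W z.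
Proof.
move=> mf mW cf df.
pose B : set (T * T) := Omega_box r `\`
  [set z | has_slope (fun y => f (z.1, y)) z.2 (W z)].
have mB : measurable B.
  by apply: measurableD; [exact: measurable_Omega_box|exact: measurable_has_slope].
exists B; split => //.
  rewrite /lebesgue2; apply: integral0_eq => t _ /=.
  have mBt : measurable (xsection B t) by exact: measurable_xsection.
  apply/(negligibleP _ mBt).1.
  apply: negligibleS (df t) => x; rewrite /xsection/= inE => -[[_]].
  rewrite /= in_itv/= => xr nslope /(_ xr)[dx dxW]; apply: nslope.
  by rewrite /= -dxW; exact: derive1_has_slope.
move=> [t x] /= /not_implyP[txr]; rewrite /B/= => nd; split => // slope.
by apply: nd; apply: has_slope_derive1.
Qed.

End joint.

Lemma clamp_time_ge0 (R : realType) (m : R -> sub_meas R) (t : R) :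
  0 <= t -> clamp_time m t = m t.
Proof. by move=> t0; rewrite /clamp_time max_l. Qed.

Lemma derive1n_convolution (R : realType) (n : nat) (G : R -> R) (mu : sub_meas R)
    (k : nat) : regular_kernel n G -> (k < n)%N ->
  derive1n k (convolution G mu) = convolution (derive1n k G) mu.
Proof.
move=> [_ reg _]; elim: k => [//|k ih] kn.
have [acH intH] := reg k (ltnW kn); have [acF intF] := reg k.+1 kn.
rewrite derive1nS ih ?(ltnW kn)//; apply: derive1_convolution => //.
  exact: absolutely_continuous_C0.
by apply: absolutely_continuous_FTC => //; apply: aeW.
Qed.

(** With N a null set off which F = G, the measure at time t charges x - N for almost no (t, x): the
    box integral of that mass is at most r times the Lebesgue measure of N, by Young's inequality
    for the indicator of N. *)
Lemma convolution_ae_eq (R : realType) (r : R) (F G : R -> R) (m : R -> sub_meas R) :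
  0 < r -> (\forall x \ae (@lebesgue_measure R), F x = G x) -> in_X m ->
  \forall z \ae lebesgue2 R, Omega_box r z ->
    convolution G (clamp_time m z.1) z.2 = convolution F (clamp_time m z.1) z.2.
Proof.
move=> r0 [N [mN N0 FGN]] mX.
have mI : measurable_fun (setT : set (measurableTypeR R)) (\1_N : R -> R).
  exact: measurable_indic.
pose A (z : measurableTypeR R * measurableTypeR R) : \bar R :=
  (\int[clamp_time m z.1]_y `|\1_N (z.2 - y) : R|%:E)%E.
have mA : measurable_fun setT A.
  apply: (measurable_integral_clamp mX (f := fun x => `|\1_N x : R|%:E)).
    exact/measurable_EFinP/measurableT_comp.
  by move=> x; rewrite lee_fin.
have intA : (\int[lebesgue2 R]_(z in Omega_box r) `|A z| = 0)%E.
  apply/eqP; rewrite eq_le integral_ge0 ?andbT//.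
  have := integral_box_convolution_le r0 mX mI.
  rewrite [X in (_ <= X * _)%E](_ : _ = 0%E) ?mul0e.
    apply: le_trans; rewrite le_eqVlt; apply/orP; left; apply/eqP.
    by apply: eq_integral => z _; rewrite gee0_abs// integral_ge0.
  under eq_integral do rewrite ger0_norm ?indicE//.
  by rewrite -[RHS]N0 -[N in RHS]setIT -integral_indic.
have mb := @measurable_Omega_box R r.
have /(ae_eq_integral_abs _ mb (measurable_funTS mA)) := intA.
apply: aeS => z /[apply] Az.
have mZ : measurable ((fun y => z.2 - y) @^-1` N : set (measurableTypeR R)).
  rewrite -[X in measurable X]setTI; apply: measurable_subl => //.
rewrite /convolution /Rintegral; congr fine.
apply: (integral_off_null mZ).
  move: Az; rewrite /A; under eq_integral do rewrite ger0_norm ?indicE//.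
  have := @integral_indic _ _ R (clamp_time m z.1) setT measurableT _ mZ.
  by rewrite setIT => <- /=.
move=> y _ /= nN; congr (_%:E); apply: contrapT => FG; apply: nN.
by apply: FGN => /= /esym.
Qed.

(** F is chosen before m, so that the same function serves the limit and all its approximants. *)
Lemma partial_x_convolution_ae (R : realType) (n : nat) (G : R -> R) (r : R)
    (k : nat) : regular_kernel n G -> 0 < r -> (k <= n)%N ->
  exists F : R -> R, integrable_on_line F /\
    forall m, in_X m -> \forall z \ae lebesgue2 R, Omega_box r z ->
      partial_x k (fun t => convolution G (m t)) z =
      convolution F (clamp_time m z.1) z.2.
Proof.
move=> reg r0; rewrite leq_eqVlt => /orP[/eqP ->|kn]; last first.
  exists (derive1n k G); split.
    by case: (reg) => _ /(_ k kn)[].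
  move=> m mX; apply: aeW => -[t x] [/=]; rewrite in_itv/= => /andP[t0 _] _.
  by rewrite /partial_x (derive1n_convolution _ reg kn) clamp_time_ge0.
case: (reg) => _ reg' [F [intF _] FG]; exists F; split => // m mX.
(* For k = n = 0 the kernel G itself is compared with F; otherwise G^(n-1) is an absolutely
   continuous primitive of F. *)
case: n => [|n] in reg reg' FG *.
  apply: aeS (convolution_ae_eq r0 FG mX) => -[t x] /= H.
  move=> [tr xr]; rewrite -H//= clamp_time_ge0//.
  by move: tr; rewrite /= in_itv/= => /andP[].
have [acH intH] := reg' n (ltnSn n).
have H0 := absolutely_continuous_C0 acH intH.
have mF : measurable_fun (setT : set (measurableTypeR R)) F.
  by apply/measurable_EFinP; exact: measurable_int intF.
have HF := absolutely_continuous_FTC acH intF FG.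
have := @ae_derive1_section R r
  (fun z => convolution (derive1n n G) (clamp_time m z.1) z.2)
  (fun z => convolution F (clamp_time m z.1) z.2)
  (measurable_convolution_clamp mX (C0_measurable H0))
  (measurable_convolution_clamp mX mF).
move=> /(_ (fun t => @continuous_convolution R _ (clamp_time m t) acH H0)) H.
apply: aeS (H _) => [[t x] /= {}H txr|t].
  rewrite -H//= /partial_x derive1nS (derive1n_convolution _ reg)//=.
  by case: txr => /=; rewrite in_itv/= => /andP[t0 _] _; rewrite clamp_time_ge0.
(* The margin 1 puts the closed interval [-r, r] inside the open one where the derivative is
   obtained. *)
have := @primitive_derivable_ae R _ _ (- r - 1) (r + 1)
  (convolution_integrable (clamp_time m t) intF)
  (fun x y _ xy _ => convolution_primitive (clamp_time m t) H0 intF HF xy).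
apply: aeS => x hx /andP[x1 x2]; apply: hx; apply/andP; split; lra.
Qed.

Theorem proposition5p2 (R : realType) (n : nat) (G : R -> R)
    (G_even : forall x : R, G (- x) = G x)
    (G_reg : regular_kernel n G)
    (mN : nat -> R -> sub_meas R) (m : R -> sub_meas R)
    (mN_X : forall N : nat, in_X (mN N)) (m_X : in_X m)
    (mN_m : forall t : R, 0 <= t -> weak_star_cvg (fun N => mN N t) (m t))
    (r : R) (r_gt0 : 0 < r) (k : nat) (k_le_n : (k <= n)%N) :
  let u : R -> R -> R := fun t => convolution G (m t) in
  let uN : nat -> R -> R -> R := fun N t => convolution G (mN N t) in
  let v : R * R -> R := fun z => partial_x k u z * \1_(Omega_box r) z in
  let vN : nat -> R * R -> R :=
    fun N z => partial_x k (uN N) z * \1_(Omega_box r) z in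
  [/\ forall N : nat, in_L1 (vN N),
      in_L1 v
    & L1_norm (fun z => vN N z - v z) @[N --> \oo] --> (0%E : \bar R)].
Proof.
move=> u uN v vN.
have [F [intF DF]] := partial_x_convolution_ae G_reg r_gt0 k_le_n.
have mF : measurable_fun (setT : set (measurableTypeR R)) F.
  by apply/measurable_EFinP; exact: measurable_int intF.
have mb := @measurable_Omega_box R r.
have mO : measurable (@Omega R : set (measurableTypeR R * measurableTypeR R)).
  rewrite (_ : @Omega R = `[0, +oo[%classic `*` setT).
    by apply: measurableX => //; exact: measurable_itv.
  by apply/seteqP; split => -[t x] /=; rewrite /Omega /= in_itv/= andbT // => -[].
have bO : Omega_box r `<=` @Omega R.
  by move=> [t x] [/=]; rewrite in_itv/= => /andP[].
(* A Borel representative of the truncated derivative, which is not itself known to be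
   measurable. *)
pose w (m' : R -> sub_meas R) (z : R * R) : R :=
  convolution F (clamp_time m' z.1) z.2 * \1_(Omega_box r) z.
have mc m' : in_X m' -> measurable_fun
    (setT : set (measurableTypeR R * measurableTypeR R))
    (fun z => convolution F (clamp_time m' z.1) z.2).
  by move=> m'X; exact: measurable_convolution_clamp.
have mw m' : in_X m' -> measurable_fun
    (setT : set (measurableTypeR R * measurableTypeR R)) (w m').
  move=> m'X; apply: measurable_funM; first exact: mc.
  exact: measurable_indic.
have vw m' : in_X m' -> \forall z \ae lebesgue2 R,
    partial_x k (fun t => convolution G (m' t)) z * \1_(Omega_box r) z = w m' z.
  move=> m'X; apply: aeS (DF m' m'X) => z H; rewrite /w indicE.
  by have [|] := boolP (z \in _); rewrite ?mulr0// inE => /H ->.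
have inL1 m' : in_X m' -> in_L1 (fun z =>
    partial_x k (fun t => convolution G (m' t)) z * \1_(Omega_box r) z).
  move=> m'X; exists (w m'); last by apply: aeS (vw m' m'X) => z ->.
  apply/integrableP; split.
    by apply/measurable_EFinP; apply: measurable_funTS; exact: mw.
  apply: (@le_lt_trans _ _ (\int[lebesgue2 R]_(z in Omega_box r)
      \int[clamp_time m' z.1]_y `|F (z.2 - y)|%:E)%E).
    rewrite integral_mkcond [leRHS]integral_mkcond.
    apply: ge0_le_integral => //.
    - by move=> z _; rewrite patchE; case: ifP.
    - apply: (measurable_restrictT _ mO).1; apply: measurable_funTS.
      by apply: measurableT_comp => //; apply/measurable_EFinP; exact: mw.
    - apply: (measurable_restrictT _ mb).1; apply: measurable_funTS.
      apply: (measurable_integral_clamp m'X (f := fun x => `|F x|%:E)).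
        exact/measurable_EFinP/measurableT_comp.
      by move=> x; rewrite lee_fin.
    move=> z _; rewrite !patchE /w indicE; have [zb|zb] := boolP (z \in Omega_box r).
      rewrite mem_set; last by apply: bO; move: zb; rewrite inE.
      by rewrite mulr1; exact: le_normr_convolution.
    by rewrite mulr0 abse0; case: ifP.
  apply: (le_lt_trans (integral_box_convolution_le r_gt0 m'X mF)).
  have F0 : (0 <= \int[@lebesgue_measure R]_x `|F x|%:E)%E.
    by apply: integral_ge0 => x _; rewrite lee_fin.
  apply: lte_mul_pinfty => //; last exact: ltry.
  by rewrite ge0_fin_numE//; case/integrableP: intF.
split; [by move=> N; exact: inL1|exact: inL1|].
have cv := cvg_box_convolution r_gt0 mN_X m_X mN_m intF.
(* For every N the norm equals the box integral already shown to converge, since it does not change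
   when both functions are replaced by their representatives. *)
apply: cvg_trans cv; apply: near_eq_cvg; apply: nearW => N; apply/esym.
have [Z [mZ Z0 vZ]] : \forall z \ae lebesgue2 R, vN N z = w (mN N) z /\ v z = w m z.
  by apply: aeS2 (vw _ (mN_X N)) (vw _ m_X) => z ? ?; split.
rewrite /L1_norm.
rewrite (integral_off_null mZ Z0 (g := fun z => `|w (mN N) z - w m z|%:E)); last first.
  move=> z _ nZ; have [h1 h2] : vN N z = w (mN N) z /\ v z = w m z.
    by apply: contrapT => H; apply: nZ; exact: vZ.
  by rewrite -h1 -h2.
rewrite integral_mkcond [RHS]integral_mkcond; apply: eq_integral => z _.
rewrite !patchE /w indicE; have [zb|zb] := boolP (z \in Omega_box r).
  by rewrite mem_set ?mulr1//; apply: bO; move: zb; rewrite inE.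
by rewrite !mulr0 subr0 normr0; case: ifP.
Qed.
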